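(* Let $L$ be a non-empty finite connected flag simplicial complex, let $M\to L$ be a connected regular covering with group of deck transformations $\pi(M,L)$, and let $S\subseteq\mathbb{Z}$. Then the group $G_L^M(S)$ is torsion-free if and only if either $S=\mathbb{Z}$ or $\pi(M,L)$ is torsion-free.
   Context: A flag complex is a simplicial complex in which every finite set of pairwise adjacent vertices spans a simplex. The covering $M\to L$ may be infinite; $M$ is triangulated so that the covering map is simplicial (so $M$ is a flag complex). For a flag complex $K$ with vertex set $K^0$, the right-angled Artin group is $A_K=\langle v\in K^0 : [v,w]=1 \text{ for every edge } \{v,w\} \text{ of } K\rangle$. The height homomorphism $\mathrm{ht}:A_K\to\mathbb{Z}$ sends every vertex to $1$, and the Bestvina-Brady group $BB_K$ is its kernel. The group $\pi=\pi(M,L)$ of deck transformations acts on $A_M$ and on $BB_M$ by permuting the vertices of $M$; form the semidirect products $BB_M\rtimes\pi\le A_M\rtimes\pi$. For $S\subseteq\mathbb{Z}$ let $N(S)$ be the subgroup generated by all $b\pi b^{-1}$ with $b\in A_M$ and $\mathrm{ht}(b)\in S$; it is a normal subgroup of $BB_M\rtimes\pi$. Define $G_L^M(S)=(BB_M\rtimes\pi)/N(S)$. *)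

(* Defs.v *)
From HB Require Import structures.
From mathcomp Require Import all_boot all_order all_algebra finmap.
From mathcomp Require Import generic_quotient.
From mathcomp Require Import all_classical all_reals all_analysis.

Set Implicit Arguments.
Unset Strict Implicit.
Unset Printing Implicit Defensive.

Import Order.TTheory GRing.Theory Num.Theory.
Import numFieldNormedType.Exports.

Local Open Scope classical_set_scope.
Local Open Scope ring_scope.
Local Open Scope quotient_scope.

Section Groups.
Local Open Scope group_scope.

Definition torsion_free (G : groupType) : Prop :=
  forall (x : G) (n : nat), (0 < n)%N -> x ^+ n = 1 -> x = 1.

Definition is_subgroup (G : groupType) (H : set G) : Prop :=
  H 1 /\ forall x y, H x -> H y -> H (x * y^-1).

Definition generated (G : groupType) (X : set G) : set G :=
  smallest (@is_subgroup G) X.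

Record normal_subgroup (G : groupType) := NormalSubgroup {
  nsub : set G;
  nsub_subgroup : is_subgroup nsub;
  nsub_conj : forall x y, nsub x -> nsub (y * x * y^-1) }.

Lemma generated_subgroup (G : groupType) (X : set G) :
  is_subgroup (generated X).
Proof.
split=> [H [HG _]|x y Hx Hy H HX]; first by case: HG.
by case: (HX) => [[_ +] _]; apply; [exact: Hx|exact: Hy].
Qed.

Lemma sub_generated (G : groupType) (X : set G) : X `<=` generated X.
Proof. by move=> x Xx H [_]; apply. Qed.

Lemma generated_conj (G : groupType) (X : set G) :
  (forall x y, X x -> X (y * x * y^-1)) ->
  forall x y, generated X x -> generated X (y * x * y^-1).
Proof.
move=> XJ x y gx; apply: (gx [set z | generated X (y * z * y^-1)]).
have [g1 gF] := generated_subgroup X.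
split; last by move=> z Xz; apply: sub_generated; exact: XJ.
split=> [|a b /= ga gb] /=; first by rewrite mulg1 mulgV.
have := gF _ _ ga gb.
by rewrite !invgM !invgK !mulgA mulgVK.
Qed.

Section Quotient.
Variables (G : groupType) (N : normal_subgroup G).

Definition same_coset : rel G := fun x y => `[< nsub N (x^-1 * y) >].

Let N1 : nsub N 1. Proof. by case: (nsub_subgroup N). Qed.
Let NF x y : nsub N x -> nsub N y -> nsub N (x * y^-1).
Proof. by case: (nsub_subgroup N) => _; apply. Qed.
Let NV x : nsub N x -> nsub N x^-1.
Proof. by move=> Nx; rewrite -[x^-1]mul1g; exact: NF. Qed.
Let NM x y : nsub N x -> nsub N y -> nsub N (x * y).
Proof. by move=> Nx Ny; rewrite -[y]invgK; apply: NF => //; exact: NV. Qed.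

Lemma same_coset_equiv : equiv_class_of same_coset.
Proof.
split=> [x|x y|y x z]; first by apply/asboolP; rewrite mulVg.
- by apply/asboolP/asboolP => /NV; rewrite invgM invgK.
- move=> /asboolP Nxy /asboolP Nyz; apply/asboolP.
  by have := NM Nxy Nyz; rewrite -mulgA mulVKg.
Qed.

Canonical same_coset_rel := EquivRelPack same_coset_equiv.

Definition quotient_group := {eq_quot same_coset}.
HB.instance Definition _ := Choice.on quotient_group.
HB.instance Definition _ := EqQuotient.on quotient_group.

Local Notation Q := quotient_group.

Lemma eq_coset (x y : G) : (\pi_Q x = \pi_Q y) <-> nsub N (x^-1 * y).
Proof.
split=> [/eqP|Nxy]; first by rewrite eqmodE => /asboolP.
by apply/eqP; rewrite eqmodE; apply/asboolP.
Qed.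

Definition qmul (x y : Q) : Q := \pi_Q (repr x * repr y).
Definition qinv (x : Q) : Q := \pi_Q ((repr x)^-1).
Definition qone : Q := \pi_Q 1.

Let reprP (x : G) : nsub N (x^-1 * repr (\pi_Q x)).
Proof. by apply/eq_coset; rewrite reprK. Qed.

Lemma qmulE x y : qmul (\pi_Q x) (\pi_Q y) = \pi_Q (x * y).
Proof.
apply/esym/eq_coset; rewrite invgM.
set x' := repr _; set y' := repr _.
have -> : y^-1 * x^-1 * (x' * y') =
    y^-1 * y' * (y'^-1 * (x^-1 * x') * y'^-1^-1).
  by rewrite invgK !mulgA mulgK.
by apply: NM; [exact: reprP|apply: nsub_conj; exact: reprP].
Qed.

Lemma qinvE x : qinv (\pi_Q x) = \pi_Q (x^-1).
Proof.
apply/esym/eq_coset; rewrite invgK; set x' := repr _.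
have -> : x * x'^-1 = x * (x^-1 * x')^-1 * x^-1.
  by rewrite invgM invgK !mulgA mulgK.
by apply: nsub_conj; apply: NV; exact: reprP.
Qed.

Lemma quotient_groupW (x : Q) : exists y, x = \pi_Q y.
Proof. by exists (repr x); rewrite reprK. Qed.
Let qmulA : associative qmul.
Proof.
move=> x y z; have [{}x ->] := quotient_groupW x; have [{}y ->] := quotient_groupW y.
by have [{}z ->] := quotient_groupW z; rewrite !qmulE mulgA.
Qed.
Let qmul1 : left_id qone qmul.
Proof. by move=> x; have [{}x ->] := quotient_groupW x; rewrite qmulE mul1g. Qed.
Let qmulr1 : right_id qone qmul.
Proof. by move=> x; have [{}x ->] := quotient_groupW x; rewrite qmulE mulg1. Qed.
Let qmulV : left_inverse qone qinv qmul.
Proof. by move=> x; have [{}x ->] := quotient_groupW x; rewrite qinvE qmulE mulVg. Qed.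
Let qmulrV : right_inverse qone qinv qmul.
Proof. by move=> x; have [{}x ->] := quotient_groupW x; rewrite qinvE qmulE mulgV. Qed.

HB.instance Definition _ := isGroup.Build Q qmulA qmul1 qmulr1 qmulV qmulrV.

Lemma quotient_mulE x y : \pi_Q x * \pi_Q y = \pi_Q (x * y).
Proof. exact: qmulE. Qed.

End Quotient.

(* Words in letters [x^{+1} = (x, true)] and [x^{-1} = (x, false)]. *)
Section Presentation.
Variables (T : choiceType) (rels : set (seq (T * bool))).

Local Notation word := (seq (T * bool)).

Definition flip (x : T * bool) := (x.1, ~~ x.2).
Definition winv (w : word) : word := rev (map flip w).

(* Congruence defining < T | rels >. *)
Inductive pres_eq : word -> word -> Prop :=
| pres_refl w : pres_eq w w
| pres_sym u w : pres_eq u w -> pres_eq w u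
| pres_trans u v w : pres_eq u v -> pres_eq v w -> pres_eq u w
| pres_cancel u x w : pres_eq (u ++ x :: flip x :: w) (u ++ w)
| pres_relator u r w : rels r -> pres_eq (u ++ r ++ w) (u ++ w).

Lemma flipK : involutive flip.
Proof. by case=> x b; rewrite /flip negbK. Qed.

Lemma winvK : involutive winv.
Proof. by move=> w; rewrite /winv map_rev revK mapK //; exact: flipK. Qed.

Lemma pres_catl a u w : pres_eq u w -> pres_eq (a ++ u) (a ++ w).
Proof.
elim=> {u w} [w|u w _|u v w _ uv _|u x w|u r w rr].
- exact: pres_refl.
- exact: pres_sym.
- exact: pres_trans uv.
- by rewrite !catA; exact: pres_cancel.
- by rewrite catA (catA a u w); exact: pres_relator.
Qed.

Lemma pres_catr a u w : pres_eq u w -> pres_eq (u ++ a) (w ++ a).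
Proof.
elim=> {u w} [w|u w _|u v w _ uv _|u x w|u r w rr].
- exact: pres_refl.
- exact: pres_sym.
- exact: pres_trans uv.
- by rewrite -!catA /=; exact: pres_cancel.
- by rewrite -!catA; exact: pres_relator.
Qed.

Lemma pres_cat u u' w w' :
  pres_eq u u' -> pres_eq w w' -> pres_eq (u ++ w) (u' ++ w').
Proof.
by move=> uu ww; apply: pres_trans (pres_catr w uu) _; exact: pres_catl.
Qed.

Lemma pres_winvr w : pres_eq (w ++ winv w) [::].
Proof.
elim: w => [|x w IHw]; first exact: pres_refl.
have -> : (x :: w) ++ winv (x :: w) = [:: x] ++ (w ++ winv w) ++ [:: flip x].
  by rewrite /winv /= rev_cons -cats1 -!catA.
apply: pres_trans (pres_catl _ (pres_catr _ IHw)) _.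
exact: (pres_cancel [::] x [::]).
Qed.

Lemma pres_winvl w : pres_eq (winv w ++ w) [::].
Proof. by rewrite -{2}[w]winvK; exact: pres_winvr. Qed.

Lemma pres_winv u w : pres_eq u w -> pres_eq (winv u) (winv w).
Proof.
move=> uw; apply: (@pres_trans _ (winv u ++ (w ++ winv w))).
  rewrite -{1}[winv u]cats0; apply: pres_catl; apply: pres_sym.
  exact: pres_winvr.
rewrite catA -{2}[winv w]cat0s; apply: pres_catr.
apply: pres_trans (pres_winvl u).
by apply: pres_catl; exact: pres_sym.
Qed.

Definition pres_rel : rel word := fun u w => `[< pres_eq u w >].

Lemma pres_rel_equiv : equiv_class_of pres_rel.
Proof.
split=> [x|x y|y x z]; first by apply/asboolP; exact: pres_refl.
- by apply/asboolP/asboolP => /pres_sym.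
- move=> /asboolP xy /asboolP yz; apply/asboolP; exact: pres_trans yz.
Qed.

Canonical pres_rel_rel := EquivRelPack pres_rel_equiv.

Definition presented_group := {eq_quot pres_rel}.
HB.instance Definition _ := Choice.on presented_group.
HB.instance Definition _ := EqQuotient.on presented_group.

Local Notation P := presented_group.

Lemma eq_presented (u w : word) : (\pi_P u = \pi_P w) <-> pres_eq u w.
Proof.
split=> [/eqP|uw]; first by rewrite eqmodE => /asboolP.
by apply/eqP; rewrite eqmodE; apply/asboolP.
Qed.

Lemma presented_repr (w : word) : pres_eq (repr (\pi_P w)) w.
Proof. by apply/eq_presented; rewrite reprK. Qed.

Definition pmul (x y : P) : P := \pi_P (repr x ++ repr y).
Definition pinv (x : P) : P := \pi_P (winv (repr x)).
Definition pone : P := \pi_P [::].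

Lemma pmulE u w : pmul (\pi_P u) (\pi_P w) = \pi_P (u ++ w).
Proof. by apply/eq_presented; apply: pres_cat; exact: presented_repr. Qed.

Lemma pinvE w : pinv (\pi_P w) = \pi_P (winv w).
Proof. by apply/eq_presented; apply: pres_winv; exact: presented_repr. Qed.

Lemma presentedW (x : P) : exists y, x = \pi_P y.
Proof. by exists (repr x); rewrite reprK. Qed.
Let pmulA : associative pmul.
Proof.
move=> x y z; have [{}x ->] := presentedW x; have [{}y ->] := presentedW y.
by have [{}z ->] := presentedW z; rewrite !pmulE catA.
Qed.
Let pmul1 : left_id pone pmul.
Proof. by move=> x; have [{}x ->] := presentedW x; rewrite pmulE. Qed.
Let pmulr1 : right_id pone pmul.
Proof. by move=> x; have [{}x ->] := presentedW x; rewrite pmulE cats0. Qed.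
Let pmulV : left_inverse pone pinv pmul.
Proof.
move=> x; have [{}x ->] := presentedW x; rewrite pinvE pmulE.
by apply/eq_presented; exact: pres_winvl.
Qed.
Let pmulrV : right_inverse pone pinv pmul.
Proof.
move=> x; have [{}x ->] := presentedW x; rewrite pinvE pmulE.
by apply/eq_presented; exact: pres_winvr.
Qed.

HB.instance Definition _ := isGroup.Build P pmulA pmul1 pmulr1 pmulV pmulrV.

Lemma presented_mulE u w : \pi_P u * \pi_P w = \pi_P (u ++ w).
Proof. exact: pmulE. Qed.

Definition pgen (x : T) : P := \pi_P [:: (x, true)].

End Presentation.

Record group_action (Q N : groupType) := GroupAction {
  gact :> Q -> N -> N;
  gact1 : forall n, gact 1 n = n;
  gactM : forall g h n, gact (g * h) n = gact g (gact h n);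
  gact_mul : forall g m n, gact g (m * n) = gact g m * gact g n }.

(* N >| Q, with product (n, g) (n', g') = (n (g n'), g g'). *)
Record sdprod_group (Q N : groupType) (a : group_action Q N) :=
  Sdprod { sdl : N; sdr : Q }.

Arguments Sdprod {Q N} a sdl sdr.

Section SemidirectProduct.
Variables (Q N : groupType) (a : group_action Q N).

Local Notation Sdprod := (Sdprod a).
Local Notation sdprod_group := (sdprod_group a).

HB.instance Definition _ := gen_eqMixin sdprod_group.
HB.instance Definition _ := gen_choiceMixin sdprod_group.

Definition sdmul (x y : sdprod_group) : sdprod_group :=
  Sdprod (sdl x * a (sdr x) (sdl y)) (sdr x * sdr y).
Definition sdone : sdprod_group := Sdprod 1 1.
Definition sdinv (x : sdprod_group) : sdprod_group :=
  Sdprod (a (sdr x)^-1 (sdl x)^-1) (sdr x)^-1.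

Lemma gact_one g : a g 1 = 1.
Proof. by apply: (mulgI (a g 1)); rewrite -gact_mul !mulg1. Qed.

Let sdmulA : associative sdmul.
Proof.
by move=> [k f] [m g] [n h]; rewrite /sdmul /= gact_mul gactM !mulgA.
Qed.
Let sdmul1 : left_id sdone sdmul.
Proof. by move=> [n g]; rewrite /sdmul /= gact1 !mul1g. Qed.
Let sdmulr1 : right_id sdone sdmul.
Proof. by move=> [n g]; rewrite /sdmul /= gact_one !mulg1. Qed.
Let sdmulV : left_inverse sdone sdinv sdmul.
Proof.
by move=> [n g]; rewrite /sdmul /sdinv /= -gact_mul !mulVg gact_one.
Qed.
Let sdmulrV : right_inverse sdone sdinv sdmul.
Proof.
by move=> [n g]; rewrite /sdmul /sdinv /= -gactM !mulgV gact1 mulgV.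
Qed.

HB.instance Definition _ :=
  isGroup.Build sdprod_group sdmulA sdmul1 sdmulr1 sdmulV sdmulrV.

Definition sd_inl (n : N) : sdprod_group := Sdprod n 1.
Definition sd_inr (g : Q) : sdprod_group := Sdprod 1 g.

Lemma sd_mulE (x y : sdprod_group) : x * y = sdmul x y.
Proof. by []. Qed.

Lemma sd_invE (x : sdprod_group) : x^-1 = sdinv x.
Proof. by []. Qed.

Lemma sd_inrM g h : sd_inr (g * h) = sd_inr g * sd_inr h.
Proof. by rewrite sd_mulE /sdmul /= gact_one mulg1. Qed.

Lemma sd_inrV g : sd_inr g^-1 = (sd_inr g)^-1.
Proof. by rewrite sd_invE /sdinv /= invg1 gact_one. Qed.

Lemma sd_inlE x b : x * sd_inl b = sd_inl (sdl x * a (sdr x) b) * sd_inr (sdr x).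
Proof. by rewrite !sd_mulE /sdmul /= gact1 !mulg1 mul1g. Qed.

Lemma sd_conj x b g :
  x * (sd_inl b * sd_inr g * (sd_inl b)^-1) * x^-1 =
  let b' := sdl x * a (sdr x) b in
  sd_inl b' * sd_inr (sdr x * g * (sdr x)^-1) * (sd_inl b')^-1.
Proof.
have -> : x * (sd_inl b * sd_inr g * (sd_inl b)^-1) * x^-1 =
    (x * sd_inl b) * sd_inr g * (x * sd_inl b)^-1 by rewrite invgM !mulgA.
by rewrite sd_inlE /= invgM !sd_inrM sd_inrV !mulgA.
Qed.

End SemidirectProduct.

End Groups.

Section PresentedMap.
Local Open Scope group_scope.
Variables (T T' : choiceType).
Variables (rels : set (seq (T * bool))) (rels' : set (seq (T' * bool))).

Definition word_map (f : T -> T') (w : seq (T * bool)) : seq (T' * bool) :=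
  [seq (f x.1, x.2) | x <- w].

Local Notation P := (presented_group rels).
Local Notation P' := (presented_group rels').

Definition presented_map (f : T -> T') (x : P) : P' := \pi_P' (word_map f (repr x)).

Variable f : T -> T'.
Hypothesis frels : forall r, rels r -> rels' (word_map f r).

Lemma pres_eq_map u w :
  pres_eq rels u w -> pres_eq rels' (word_map f u) (word_map f w).
Proof.
elim=> {u w} [w|u w _|u v w _ uv _|u x w|u r w rr].
- exact: pres_refl.
- exact: pres_sym.
- exact: pres_trans uv.
- rewrite /word_map !map_cat /=; exact: (@pres_cancel _ _ _ (f x.1, x.2)).
- by rewrite /word_map !map_cat; apply: pres_relator; exact: frels.
Qed.

Lemma presented_mapE w : presented_map f (\pi_P w) = \pi_P' (word_map f w).
Proof.
by apply/eq_presented; apply: pres_eq_map; exact: presented_repr.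
Qed.

Lemma presented_mapM x y : presented_map f (x * y) = presented_map f x * presented_map f y.
Proof.
have [u ->] := presentedW x; have [w ->] := presentedW y.
by rewrite presented_mulE !presented_mapE presented_mulE /word_map map_cat.
Qed.

End PresentedMap.

Section Coverings.
Variables X Y : topologicalType.

(* [p] is assumed to be continuous, so "bijective and open" on [W i] says that
   [p] restricts to a homeomorphism from [W i] onto [U]. *)
Definition evenly_covered (p : X -> Y) (U : set Y) : Prop :=
  exists (I : Type) (W : I -> set X),
    [/\ forall i, open (W i), trivIset setT W, p @^-1` U = \bigcup_i W i &
        forall i, set_bij (W i) U p /\
          (forall O, open O -> O `<=` W i -> open (p @` O))].

Definition covering_map (p : X -> Y) : Prop :=
  [/\ continuous p, set_surj setT setT p &
      forall y, exists U, open_nbhs y U /\ evenly_covered p U].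

Record deck (p : X -> Y) := Deck {
  deck_fun :> X -> X;
  deck_inv : X -> X;
  deck_funK : cancel deck_fun deck_inv;
  deck_invK : cancel deck_inv deck_fun;
  deck_continuous : continuous deck_fun;
  deck_inv_continuous : continuous deck_inv;
  deck_over : forall x, p (deck_fun x) = p x }.

Section DeckGroup.
Variable p : X -> Y.

HB.instance Definition _ := gen_eqMixin (deck p).
HB.instance Definition _ := gen_choiceMixin (deck p).

Lemma deck_eq (f g : deck p) : (forall x, f x = g x) -> f = g.
Proof.
move=> fg; have {}fg : deck_fun f = deck_fun g by apply/funext.
have : deck_inv f = deck_inv g.
  apply/funext => x; apply: (can_inj (deck_funK f)).
  by rewrite deck_invK fg deck_invK.
case: f g fg => [f f' ? ? ? ? ?] [g g' ? ? ? ? ?] /= ? ?; subst g g'.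
by congr Deck; exact: Prop_irrelevance.
Qed.

Let one_continuous : continuous (@id X).
Proof. by move=> x. Qed.

Definition deck_one : deck p :=
  @Deck p id id (fun=> erefl) (fun=> erefl)
    one_continuous one_continuous (fun=> erefl).

Section Operations.
Variables f g : deck p.

Let mulK : cancel (f \o g) (deck_inv g \o deck_inv f).
Proof. by move=> x /=; rewrite !deck_funK. Qed.
Let mul_invK : cancel (deck_inv g \o deck_inv f) (f \o g).
Proof. by move=> x /=; rewrite !deck_invK. Qed.
Let mul_continuous : continuous (f \o g).
Proof. by move=> x; apply: continuous_comp; exact: deck_continuous. Qed.
Let mul_inv_continuous : continuous (deck_inv g \o deck_inv f).
Proof. by move=> x; apply: continuous_comp; exact: deck_inv_continuous. Qed.
Let mul_over x : p ((f \o g) x) = p x.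
Proof. by rewrite /= !deck_over. Qed.
Let inv_over x : p (deck_inv f x) = p x.
Proof. by rewrite -(deck_over f) deck_invK. Qed.

Definition deck_mul : deck p :=
  Deck mulK mul_invK mul_continuous mul_inv_continuous mul_over.

Definition deck_invg : deck p :=
  Deck (deck_invK f) (deck_funK f) (@deck_inv_continuous _ f)
    (@deck_continuous _ f) inv_over.

End Operations.

Let deck_mulA : associative deck_mul. Proof. by move=> *; apply: deck_eq. Qed.
Let deck_mul1 : left_id deck_one deck_mul.
Proof. by move=> *; apply: deck_eq. Qed.
Let deck_mulr1 : right_id deck_one deck_mul.
Proof. by move=> *; apply: deck_eq. Qed.
Let deck_mulV : left_inverse deck_one deck_invg deck_mul.
Proof. by move=> f; apply: deck_eq => x; exact: deck_funK. Qed.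
Let deck_mulrV : right_inverse deck_one deck_invg deck_mul.
Proof. by move=> f; apply: deck_eq => x; exact: deck_invK. Qed.

HB.instance Definition _ := isGroup.Build (deck p)
  deck_mulA deck_mul1 deck_mulr1 deck_mulV deck_mulrV.

End DeckGroup.

Definition regular_covering (p : X -> Y) : Prop :=
  covering_map p /\ forall x x', p x = p x' -> exists g : deck p, g x = x'.

Lemma covering_locally_injective (p : X -> Y) x : covering_map p ->
  exists2 W, open_nbhs x W & {in W &, injective p}.
Proof.
move=> [_ _ /(_ (p x))[U [[_ Upx] [I [W [oW _ pU pW]]]]]].
have : (p @^-1` U) x by [].
rewrite pU => -[i _ Wix]; exists (W i); first by split.
by case: (pW i) => -[_ /[swap] _ + _].
Qed.

End Coverings.

Record simplicial_complex := SimplicialComplex {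
  vertex :> choiceType;
  simplex : {fset vertex} -> Prop;
  simplex_neq0 : forall s, simplex s -> s != fset0;
  simplex_sub : forall s t : {fset vertex},
    simplex s -> (t `<=` s)%fset -> t != fset0 -> simplex t;
  simplex1 : forall v, simplex [fset v]%fset }.

Definition edge (K : simplicial_complex) (v w : K) : Prop :=
  v != w /\ simplex [fset v; w]%fset.

Definition flag (K : simplicial_complex) : Prop :=
  forall s : {fset K}, s != fset0 ->
    {in s &, forall v w, v != w -> edge v w} -> simplex s.

Definition finite_complex (K : simplicial_complex) : Prop :=
  finite_set [set: K].

Record simplicial_map (K L : simplicial_complex) := SimplicialMap {
  smap :> K -> L;
  smap_simplex : forall s, simplex s -> simplex (smap @` s)%fset }.

Section Realization.
Variables (R : realType) (K : simplicial_complex).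

(* The closed simplex spanned by [s], in barycentric coordinates. *)
Definition closed_simplex (s : {fset K}) : set (K -> R) :=
  [set t | [/\ forall v, 0 <= t v, forall v, v \notin s -> t v = 0 &
               \sum_(v <- s) t v = 1]].

Record realization := Realization {
  bary :> K -> R;
  baryP : exists2 s, simplex s & closed_simplex s bary }.

HB.instance Definition _ := gen_eqMixin realization.
HB.instance Definition _ := gen_choiceMixin realization.

Lemma bary_inj (x y : realization) : (forall v, x v = y v) -> x = y.
Proof.
case: x y => [x xP] [y yP] /= /funext xy; subst y.
by congr Realization; exact: Prop_irrelevance.
Qed.

(* The weak topology: a set is open when its trace on every closed simplex is
   open for the Euclidean topology. *)
Definition realization_open (U : set realization) : Prop :=
  forall (s : {fset K}) (x : realization), simplex s -> closed_simplex s x ->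
    U x -> exists2 e : R, 0 < e &
      forall y : realization, closed_simplex s y ->
        (forall v, v \in s -> `|x v - y v| < e) -> U y.

Let realization_openT : realization_open setT.
Proof. by move=> s x _ _ _; exists 1. Qed.
Let realization_openI : setI_closed realization_open.
Proof.
move=> U V oU oV s x ss sx [Ux Vx].
have [e e0 eU] := oU s x ss sx Ux; have [d d0 dV] := oV s x ss sx Vx.
exists (Num.min e d); first by rewrite lt_min e0.
move=> y sy xy; split; [apply: eU => // v vs|apply: dV => // v vs];
  by have := xy v vs; rewrite lt_min => /andP[].
Qed.
Let realization_open_bigU (I : Type) (U : I -> set realization) :
  (forall i, realization_open (U i)) -> realization_open (\bigcup_i U i).
Proof.
move=> oU s x ss sx [i _ Uix]; have [e e0 eU] := oU i s x ss sx Uix.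
by exists e => // y sy xy; exists i => //; exact: eU.
Qed.

HB.instance Definition _ := isOpenTopological.Build realization
  realization_openT realization_openI realization_open_bigU.

Lemma realization_openE : open = realization_open :> set_system realization.
Proof. by []. Qed.

Definition vtx_fun (v : K) : K -> R := fun u => (u == v)%:R.

Fact vtx_subproof v : exists2 s, simplex s & closed_simplex s (vtx_fun v).
Proof.
exists [fset v]%fset; first exact: simplex1.
split=> [u|u|]; rewrite /vtx_fun ?ler0n //.
  by rewrite in_fset1 => /negbTE ->.
by rewrite big_seq_fset1 eqxx.
Qed.

Definition vtx (v : K) : realization := Realization (vtx_subproof v).

End Realization.

Arguments vtx R {K} v.

Section RealizationTheory.
Variables (R : realType) (K : simplicial_complex).
Implicit Types (s : {fset K}) (x : realization R K).

Lemma bary_ge0 x v : 0 <= x v.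
Proof. by case: (baryP x) => s _ []. Qed.

Lemma closed_simplex_supp s x v : closed_simplex s x -> x v != 0 -> v \in s.
Proof. by move=> [_ x0 _]; apply: contraNT => /x0 ->. Qed.

Lemma bary_supp_neq0 x : exists v, x v != 0.
Proof.
have [s ss [_ _ x1]] := baryP x; apply: contrapT => x0.
move: x1; rewrite big1 => [/esym/eqP|v _]; first by rewrite oner_eq0.
by apply/eqP; apply: contrapT => /negP xv; apply: x0; exists v.
Qed.

Lemma bary_supp_simplex x v w : x v != 0 -> x w != 0 ->
  simplex [fset v; w]%fset.
Proof.
move=> xv xw; have [s ss sx] := baryP x; apply: simplex_sub ss _ _.
  apply/fsubsetP => u; rewrite !inE.
  by move=> /orP[] /eqP ->; exact: closed_simplex_supp sx _.
by apply/fset0Pn; exists v; rewrite !inE eqxx.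
Qed.

Lemma bary_vtx x v : (forall u, x u != 0 -> u = v) -> x = vtx R v.
Proof.
move=> xv; have [s ss sx] := baryP x; have [u xu] := bary_supp_neq0 x.
have uv := xv _ xu; subst u; have vs := closed_simplex_supp sx xu.
have x0 u : u != v -> x u = 0.
  by move=> uv; apply/eqP; apply: contraNT uv => /xv ->.
apply: bary_inj => u; rewrite /= /vtx_fun.
have [->|/x0 //] := eqVneq u v.
case: sx => _ _; rewrite (bigD1_seq v) //= big1 ?addr0 // => w; exact: x0.
Qed.

Lemma vtx_inj : injective (@vtx R K).
Proof.
move=> v w /(congr1 (fun x : realization R K => x v)) /=.
rewrite /vtx_fun eqxx; case: eqVneq => // _ /eqP; by rewrite oner_eq0.
Qed.

Lemma bary_continuous v : continuous (fun x : realization R K => x v).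
Proof.
apply/continuousP => U oU; rewrite realization_openE => s x ss sx Ux.
have /nbhs_ballP[e /= e0 eU] : nbhs (x v) U by exact: open_nbhs_nbhs.
exists e => // y sy xy; have [vs|vs] := boolP (v \in s).
  by apply: eU; exact: xy.
case: sx => _ /(_ _ vs) xv _; case: sy => _ /(_ _ vs) yv _.
by rewrite /preimage /= yv -xv.
Qed.

End RealizationTheory.

Lemma big_delta (T : choiceType) (R : pzRingType) (s : seq T) (P : pred T) v
    (d : R) : uniq s -> v \in s ->
  \sum_(k <- s | P k) (k == v)%:R * d = (P v)%:R * d.
Proof.
move=> us vs; rewrite big_mkcond (bigD1_seq v) //= big1 ?addr0 => [|k /negbTE ->].
  by rewrite eqxx mul1r; case: ifP; rewrite ?mul1r ?mul0r.
by rewrite mul0r if_same.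
Qed.

Section RealizationMap.
Variables (R : realType) (K L : simplicial_complex) (f : simplicial_map K L).

(* The map that is affine on simplices and extends [f]. *)
Definition realize_fun (x : realization R K) : L -> R :=
  fun w => \sum_(v \in f @^-1` [set w]) x v.

Lemma realize_funE s (x : realization R K) w : closed_simplex s x ->
  realize_fun x w = \sum_(v <- s | f v == w) x v.
Proof.
move=> [_ x0 _]; rewrite bigfs //=; last by move=> v _; exact: x0.
by apply: eq_fsbigl; apply/seteqP; split=> v /= /eqP.
Qed.

Fact realize_subproof x :
  exists2 s, simplex s & closed_simplex s (realize_fun x).
Proof.
have [s ss sx] := baryP x; exists (f @` s)%fset; first exact: smap_simplex.
have fE w := realize_funE w sx.
split=> [w|w fs|].
- by rewrite fE; apply: sumr_ge0 => v _; exact: bary_ge0.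
- rewrite fE big_seq_cond big1 // => v /andP[vs /eqP fv].
  by move: fs; rewrite -fv in_imfset.
- under eq_bigr do rewrite fE.
  rewrite (exchange_big_dep predT) //=.
  case: (sx) => _ _ <-; apply: eq_big_seq => v vs.
  rewrite big_mkcond (bigD1_seq (f v)) ?in_imfset ?fset_uniq //= eqxx.
  by rewrite big1 ?addr0 // => w; rewrite eq_sym => /negbTE ->.
Qed.

Definition realize (x : realization R K) : realization R L :=
  Realization (realize_subproof x).

Lemma realize_vtx v : realize (vtx R v) = vtx R (f v).
Proof.
have sv : closed_simplex [fset v]%fset (vtx R v).
  split=> [u|u|]; rewrite /= /vtx_fun ?ler0n //.
    by rewrite in_fset1 => /negbTE ->.
  by rewrite big_seq_fset1 eqxx.
apply: bary_inj => w; rewrite /= (realize_funE w sv) /= /vtx_fun.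
rewrite big_mkcond big_seq_fset1 eqxx [w == _]eq_sym.
by case: ifP.
Qed.

End RealizationMap.

Arguments realize R {K L} f.

Record simplicial_covering (R : realType) (M L : simplicial_complex) :=
  SimplicialCovering {
    cov_map :> simplicial_map M L;
    cov_covering : covering_map (realize R cov_map) }.

Definition connected_complex (R : realType) (K : simplicial_complex) : Prop :=
  connected [set: realization R K].

Section DeckAction.
Variables (R : realType) (M L : simplicial_complex).
Variable p : simplicial_covering R M L.

Local Notation rp := (realize R p).

Definition deck_group := deck rp.
HB.instance Definition _ := Group.on deck_group.

Implicit Types (g h : deck_group) (v w : M) (x : realization R M).

Lemma covering_supp_inj x v w : x v != 0 -> x w != 0 -> p v = p w -> v = w.
Proof.
move=> xv xw pvw; apply/eqP; apply: contrapT => /negP vw.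
have [W [oW Wx] Winj] := covering_locally_injective x (cov_covering p).
have [s ss sx] := baryP x.
have vs := closed_simplex_supp sx xv; have ws := closed_simplex_supp sx xw.
move: (oW); rewrite realization_openE => /(_ s x ss sx Wx)[e e0 eW].
have xv0 : 0 < x v by rewrite lt_def xv bary_ge0.
pose d := Num.min (e / 2) (x v).
have d0 : 0 < d by rewrite lt_min divr_gt0.
have de : d < e.
  by rewrite (@le_lt_trans _ _ (e / 2)) ?ge_min ?lexx //
    ltr_pdivrMr // ltr_pMr // ltr1n.
have dv : d <= x v by rewrite ge_min lexx orbT.
pose yf k := x k + ((k == w)%:R * d - (k == v)%:R * d).
have us := fset_uniq s.
have sumy (P : pred M) : \sum_(k <- s | P k) yf k =
    \sum_(k <- s | P k) x k + ((P w)%:R * d - (P v)%:R * d).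
  by rewrite !big_split /= sumrN !big_delta.
have sy : closed_simplex s yf.
  case: sx => x0 xs x1; split=> [k|k ks|]; last by rewrite sumy x1 subrr addr0.
    rewrite /yf; have [->|kv] := eqVneq k v.
      by rewrite (negbTE vw) mul0r sub0r mul1r subr_ge0.
    by rewrite mul0r subr0 addr_ge0 ?mulr_ge0 ?ler0n ?(ltW d0).
  rewrite /yf xs // add0r.
  have /negbTE -> : k != w by apply: contraNneq ks => ->.
  have /negbTE -> : k != v by apply: contraNneq ks => ->.
  by rewrite subrr.
pose y := Realization (ex_intro2 _ _ s ss sy).
have Wy : W y.
  apply: eW => // k ks; rewrite /= /yf opprD addNKr normrN.
  apply: le_lt_trans de; have [->|kv] := eqVneq k v.
    by rewrite (negbTE vw) mul0r sub0r normrN mul1r gtr0_norm.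
  rewrite mul0r subr0; case: eqP => _; rewrite ?mul0r ?normr0 ?(ltW d0) //.
  by rewrite mul1r gtr0_norm.
have : x = y.
  apply: Winj; rewrite ?inE //; apply: bary_inj => u.
  rewrite /= (realize_funE p u sx) (@realize_funE _ _ _ p s y u sy) /= sumy.
  by rewrite pvw subrr addr0.
move=> /(congr1 (fun z : realization R M => z w)) /= /eqP.
rewrite /yf eqxx [w == v]eq_sym (negbTE vw) mul0r subr0 mul1r.
by rewrite -subr_eq0 opprD addNKr oppr_eq0 gt_eqF.
Qed.

Lemma covering_coord x v : x v != 0 -> rp x (p v) = x v.
Proof.
move=> xv; have [s ss sx] := baryP x; have vs := closed_simplex_supp sx xv.
rewrite /= (realize_funE p _ sx) big_mkcond (bigD1_seq v) ?fset_uniq //= eqxx.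
rewrite big1 ?addr0 // => w wv; case: eqP => // pwv.
apply/eqP; apply: contrapT => /negP xw; move/eqP: wv; apply.
exact: covering_supp_inj xw xv pwv.
Qed.

Lemma deck_vtx g v : exists w, g (vtx R v) = vtx R w.
Proof.
set x := g _; have [u xu] := bary_supp_neq0 x; exists u.
have px : rp x = vtx R (p v) by rewrite deck_over realize_vtx.
have pv w : x w != 0 -> p w = p v.
  move=> xw; have := covering_coord xw; rewrite px /= /vtx_fun.
  by case: eqP => // _ /esym/eqP; rewrite (negbTE xw).
apply: bary_vtx => w xw; apply: covering_supp_inj (xw) (xu) _.
by rewrite (pv _ xw) (pv _ xu).
Qed.

(* The permutation of the vertices of [M] induced by [g]. *)
Definition deck_act g v : M := sval (cid (deck_vtx g v)).

Lemma deck_actE g v : g (vtx R v) = vtx R (deck_act g v).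
Proof. by rewrite /deck_act; case: cid. Qed.

Lemma deck_act1 v : deck_act 1%g v = v.
Proof. by apply: (@vtx_inj R); rewrite -deck_actE. Qed.

Lemma deck_actM g h v : deck_act (g * h)%g v = deck_act g (deck_act h v).
Proof. by apply: (@vtx_inj R); rewrite -!deck_actE. Qed.

Lemma deck_act_over g v : p (deck_act g v) = p v.
Proof.
apply: (@vtx_inj R); rewrite -!realize_vtx -deck_actE.
exact: deck_over.
Qed.

Lemma deck_act_inj g : injective (deck_act g).
Proof.
move=> v w vw; rewrite -[v]deck_act1 -[w]deck_act1 -(mulVg g).
by rewrite !deck_actM vw.
Qed.

Section Segment.
Variables (v w : M) (vw : edge v w).

Let clamp (s : R) : R := Num.max 0 (Num.min s 1).
Let clamp_ge0 s : 0 <= clamp s.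
Proof. by rewrite le_max lexx. Qed.
Let clamp_le1 s : clamp s <= 1.
Proof. by rewrite ge_max ler01 ge_min lexx orbT. Qed.
Let clampE s : 0 <= s <= 1 -> clamp s = s.
Proof. by move=> /andP[s0 s1]; rewrite /clamp (min_idPl s1) (max_idPr s0). Qed.
Let clamp_continuous : continuous clamp.
Proof.
apply: (@max_fun_continuous _ R R (cst 0) (fun s => Num.min s 1)).
  exact: cst_continuous.
apply: (@min_fun_continuous _ R R id (cst 1)); last exact: cst_continuous.
by move=> s.
Qed.

Definition seg_fun (s : R) : M -> R :=
  fun u => (u == v)%:R * (1 - clamp s) + (u == w)%:R * clamp s.

Let segP s : closed_simplex [fset v; w]%fset (seg_fun s).
Proof.
split=> [u|u|]; rewrite /seg_fun.
- by rewrite addr_ge0 ?mulr_ge0 ?ler0n ?subr_ge0.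
- by rewrite !inE negb_or => /andP[/negbTE -> /negbTE ->]; rewrite !mul0r addr0.
- by rewrite big_split /= !big_delta ?fset_uniq ?inE ?eqxx ?orbT // !mul1r subrK.
Qed.

(* The segment from [v] (at time 0) to [w] (at time 1). *)
Definition seg (s : R) : realization R M :=
  Realization (ex_intro2 _ _ _ (proj2 vw) (segP s)).

Let seg_continuous : continuous seg.
Proof.
apply/continuousP => U; rewrite realization_openE => oU.
rewrite openE => s Us; have [e e0 eU] := oU _ (seg s) (proj2 vw) (segP s) Us.
have /= := @clamp_continuous s.
move=> /cvgrPdist_lt /(_ _ e0); apply: filterS => s' ss'.
apply: eU; first exact: segP.
move=> u; rewrite !inE /= /seg_fun => /orP[] /eqP ->.
- rewrite eqxx (negbTE (proj1 vw)) !mul1r !mul0r !addr0.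
  by rewrite opprB [X in `|X|]addrC addrA subrK distrC.
- by rewrite eqxx eq_sym (negbTE (proj1 vw)) !mul1r !mul0r !add0r.
Qed.

Let seg0 : seg 0 = vtx R v.
Proof.
apply: bary_inj => u; rewrite /= /seg_fun /vtx_fun clampE ?lexx ?ler01 //.
by rewrite subr0 mulr1 mulr0 addr0.
Qed.

Let half01 : 0 <= (2^-1 : R) <= 1.
Proof. by rewrite invr_ge0 ler0n invf_le1 ?ltr0n // ler1n. Qed.

Let half_sub : 1 - 2^-1 = 2^-1 :> R.
Proof. by rewrite {1}[1]splitr div1r addrK. Qed.

Lemma seg_half u : seg 2^-1 u = ((u == v) || (u == w))%:R / 2.
Proof.
rewrite /= /seg_fun clampE // half_sub.
have [->|uv] := eqVneq u v; first by rewrite (negbTE (proj1 vw)) mul0r addr0.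
by rewrite mul0r add0r.
Qed.

Let p_neq : p v != p w.
Proof.
apply/eqP => pvw; have /eqP := proj1 vw; apply.
apply: (@covering_supp_inj (seg 2^-1)) pvw; rewrite seg_half eqxx ?orbT;
  by rewrite mul1r.
Qed.

Let p_seg s : 0 <= s <= 1 -> rp (seg s) (p v) = 1 - s.
Proof.
move=> s01; rewrite /= (@realize_funE _ _ _ p _ (seg s) _ (segP s)) /= /seg_fun big_split /=.
rewrite !big_delta ?fset_uniq ?inE ?eqxx ?orbT // eq_sym (negbTE p_neq).
by rewrite mul1r mul0r addr0 clampE.
Qed.

Lemma deck_seg_half g : g (seg 2^-1) (deck_act g v) != 0.
Proof.
pose f s : R := g (seg s) (deck_act g v).
have f01 s : 0 <= s <= 1 -> f s != 0 -> f s = 1 - s.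
  move=> s01 fs; rewrite -p_seg // -(deck_over g).
  by rewrite -(deck_act_over g v) covering_coord.
have f_continuous : continuous f.
  move=> s; apply: (@continuous_comp _ _ _ (g \o seg)
    (fun x : realization R M => x (deck_act g v))).
    by apply: continuous_comp; [exact: seg_continuous|exact: deck_continuous].
  exact: bary_continuous.
have f0 : f 0 = 1 by rewrite /f seg0 deck_actE /= /vtx_fun eqxx.
rewrite -/(f _); apply/eqP => fh.
have [|||c] := @IVT R f 0 2^-1 4^-1.
- by case/andP: half01.
- exact: continuous_subspaceT.
- rewrite f0 fh (min_idPr ler01) (max_idPl ler01).
  by rewrite invr_ge0 ler0n invf_le1 ?ltr0n // ler1n.
rewrite in_itv /= => /andP[c0 ch] fc.
have c01 : 0 <= c <= 1 by rewrite c0 (le_trans ch) //; case/andP: half01.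
have : f c != 0 by rewrite fc invr_neq0 // pnatr_eq0.
move=> /(f01 c c01); rewrite fc => cE.
have : 2^-1 <= 1 - c by rewrite lerBrDr -lerBrDl half_sub.
by rewrite -cE lef_pV2 ?posrE ?ltr0n // ler_nat.
Qed.

End Segment.

Lemma edge_sym (K : simplicial_complex) (v w : K) : edge v w -> edge w v.
Proof. by move=> [vw svw]; split; rewrite 1?eq_sym // fsetUC. Qed.

Lemma deck_act_edge g v w : edge v w -> edge (deck_act g v) (deck_act g w).
Proof.
move=> vw; split; first by rewrite (inj_eq (@deck_act_inj g)) (proj1 vw).
have gv := deck_seg_half vw g; have gw := deck_seg_half (edge_sym vw) g.
have E : seg (edge_sym vw) 2^-1 = seg vw 2^-1.
  by apply: bary_inj => u; rewrite !seg_half orbC.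
by rewrite E in gw; exact: bary_supp_simplex gv gw.
Qed.

End DeckAction.

Section Raag.
Local Open Scope group_scope.
Variable K : simplicial_complex.

(* The relators v w v^-1 w^-1 for the edges {v, w} of K. *)
Definition raag_rels : set (seq (K * bool)) :=
  [set r | exists v w, edge v w /\
     r = [:: (v, true); (w, true); (v, false); (w, false)]].

Definition raag := presented_group raag_rels.
HB.instance Definition _ := Group.on raag.

Definition raag_gen (v : K) : raag := pgen raag_rels v.

Definition word_height (w : seq (K * bool)) : int :=
  (\sum_(x <- w) if x.2 then 1 else -1)%R.

Lemma word_height_eq u w : pres_eq raag_rels u w ->
  word_height u = word_height w.
Proof.
elim=> {u w} // [u v w _ -> _ -> //|u x w|u r w [v [v' [_ ->]]]].
- rewrite /word_height !big_cat !big_cons /=.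
  by congr +%R; case: x.2; rewrite /= addrA ?subrr ?addNr add0r.
- by rewrite /word_height !big_cat !big_cons big_nil /= addr0 !addrA !addrK.
Qed.

(* The exponent sum, i.e. the homomorphism sending every vertex to 1. *)
Definition ht (x : raag) : int := word_height (repr x).

Lemma htE w : ht (\pi_raag w) = word_height w.
Proof. by apply: word_height_eq; exact: presented_repr. Qed.

Lemma ht_gen v : ht (raag_gen v) = 1%R.
Proof. by rewrite /raag_gen /pgen htE /word_height big_seq1. Qed.

Lemma htM x y : ht (x * y) = (ht x + ht y)%R.
Proof.
by rewrite /mul /= /pmul htE /word_height big_cat.
Qed.

Lemma ht1 : ht 1 = 0%R.
Proof. by rewrite /one /= /pone htE /word_height big_nil. Qed.

Lemma htV x : ht x^-1 = (- ht x)%R.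
Proof. by apply/eqP; rewrite -addr_eq0 -htM mulVg ht1. Qed.

Definition bestvina_brady : {pred raag} := [pred x | ht x == 0%R].

End Raag.

Arguments raag_rels K : clear implicits.
Arguments bestvina_brady K : clear implicits.

Section GLM.
Local Open Scope group_scope.
Variables (R : realType) (M L : simplicial_complex).
Variable p : simplicial_covering R M L.

Definition raag_act (g : deck_group p) (x : raag M) : raag M :=
  presented_map (raag_rels M) (deck_act g) x.

Let deck_act_rels (g : deck_group p) r :
  raag_rels M r -> raag_rels M (word_map (deck_act g) r).
Proof.
move=> [v [w [vw ->]]]; exists (deck_act g v), (deck_act g w); split => //.
exact: deck_act_edge.
Qed.

Lemma raag_actE g w :
  raag_act g (\pi_(raag M) w) = \pi_(raag M) (word_map (deck_act g) w).
Proof. by apply: presented_mapE; exact: deck_act_rels. Qed.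

Lemma raag_act_gen g v : raag_act g (raag_gen v) = raag_gen (deck_act g v).
Proof. exact: raag_actE. Qed.

Let raag_act1 x : raag_act 1 x = x.
Proof.
have [w ->] := presentedW x; rewrite raag_actE; congr (\pi_(raag M) _).
by rewrite /word_map map_id_in // => -[v b] _ /=; rewrite deck_act1.
Qed.

Let raag_actM g h x : raag_act (g * h) x = raag_act g (raag_act h x).
Proof.
have [w ->] := presentedW x; rewrite (raag_actE h) !raag_actE; congr (\pi_(raag M) _).
rewrite /word_map -map_comp; apply: eq_map => -[v b] /=.
by rewrite deck_actM.
Qed.

Let raag_act_mul g x y : raag_act g (x * y) = raag_act g x * raag_act g y.
Proof. by apply: presented_mapM; exact: deck_act_rels. Qed.

Definition raag_action : group_action (deck_group p) (raag M) :=
  GroupAction raag_act1 raag_actM raag_act_mul.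

Lemma ht_act g x : ht (raag_act g x) = ht x.
Proof.
rewrite -[x]reprK raag_actE !htE /word_height big_map.
by apply: eq_bigr.
Qed.

Definition raag_deck := sdprod_group raag_action.
HB.instance Definition _ := Group.on raag_deck.

Definition bb_deck : {pred raag_deck} :=
  [pred x | sdl x \in bestvina_brady M].

Lemma bb_deck_closed : group_closed bb_deck.
Proof.
split; first by rewrite !inE /= ht1.
move=> x y; rewrite !inE /= => /eqP x0 /eqP y0.
by rewrite htM !ht_act htV x0 y0.
Qed.

Definition bb_deck_group := {x : raag_deck | bb_deck x}.
HB.instance Definition _ := SubChoice.on bb_deck_group.
HB.instance Definition _ :=
  SubChoice_isSubGroup.Build raag_deck bb_deck bb_deck_group bb_deck_closed.

Definition deck_conjugates (S : set int) : set bb_deck_group :=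
  [set x | exists b g, S (ht b) /\
     val x = sd_inl raag_action b * sd_inr raag_action g *
             (sd_inl raag_action b)^-1].

Lemma deck_conjugatesJ S x y :
  deck_conjugates S x -> deck_conjugates S (y * x * y^-1).
Proof.
move=> [b [g [Sb xE]]]; exists (sdl (val y) * raag_act (sdr (val y)) b).
exists (sdr (val y) * g * (sdr (val y))^-1); split.
  have /eqP y0 : ht (sdl (val y)) == 0%R := valP y.
  by rewrite htM ht_act y0 add0r.
by apply: etrans (sd_conj (val y) b g); rewrite -xE.
Qed.

Definition N_subgroup (S : set int) : normal_subgroup bb_deck_group :=
  NormalSubgroup (generated_subgroup (deck_conjugates S))
    (generated_conj (@deck_conjugatesJ S)).

Definition GLM (S : set int) := quotient_group (N_subgroup S).
HB.instance Definition _ S := Group.on (GLM S).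

End GLM.

(* Main.v *)
Require Import Defs.
From HB Require Import structures.
From mathcomp Require Import all_boot all_order all_algebra finmap.
From mathcomp Require Import all_classical all_reals all_analysis.

(** Write [Gamma] for [A_M x| pi], [q : Gamma -> A_L] for the projection, which
    kills [pi], and [K] for its kernel. The subgroup [N(S)] lies in [K], and
    everything rests on one map [f : K -> Gamma] ([kernel_retraction]): it is a
    homomorphism, it kills [N(S)], it satisfies [f x = x] modulo [N(S)], and it
    is injective on [b pi b^-1] when the height of [b] is not in [S].
    Geometrically, [Gamma] acts on the cube complex of [A_M] with quotient by
    [K] the cube complex of [A_L]; the latter is simply connected, [K] is the
    free product of the stabilizers, all conjugate to [pi], of suitably chosen
    lifts of its vertices, and [f] kills those factors whose height is in [S].

    The theorem follows. If [S] omits the height of [b] then [b pi b^-1] embeds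
    in the quotient, so torsion in [pi] gives torsion there
    ([torsion_free_deck]). Conversely let [x ^ n] be in [N(S)]. Right-angled
    Artin groups are torsion-free ([raag_torsion_free]), so [q x = 1]. If [S]
    is everything, then [N(S) = K] ([raag_proj_kernel]), as lifting vertices and
    edges from [L] to [M] inverts [q] modulo [N(S)]. If [pi] is torsion-free,
    then so is [Gamma], hence [f x = 1] and [x] is in [N(S)]
    ([torsion_free_quotient]).

    To construct [f], let [Gamma] act through [q] on the functions
    [A_L -> Gamma] and form the semidirect product [W] of these functions with
    [Gamma]. A splitting [T : Gamma -> W] whose value at [g] in [pi] has the
    coordinate [1] at the points [x] with [- ht x] in [S] and [g] elsewhere
    gives [f], by evaluating at the coordinate [1]. It is built one vertex [u]
    of [L] at a time ([partial_lift_extend]): for one lift [v0] of [u], an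
    element of [W] over [v0] is needed that commutes with the elements already
    chosen for the vertices adjacent to [v0]. Since [L] is flag, the link of
    [v0] is that of [u], and it generates a subgroup of [A_L] that lifts to
    [W]; this subgroup acts freely on [A_L], so a twisted form of Shapiro's
    lemma provides the element ([coind_commutant]). Transport by [pi], which
    permutes the lifts of [u] simply transitively, gives the other lifts.

    A right-angled Artin group is torsion-free because adding a vertex [v] to
    the defining graph embeds the new group in the semidirect product of a free
    group with the old one ([killed_torsion_free_step]). *)

Set Implicit Arguments.
Unset Strict Implicit.
Unset Printing Implicit Defensive.

Import Order.TTheory GRing.Theory Num.Theory.
Import numFieldNormedType.Exports.

Local Open Scope classical_set_scope.
Local Open Scope group_scope.
Local Open Scope quotient_scope.

(** * Homomorphisms, subgroups and presentations *)

Section Morphisms.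
Variables (G H : groupType) (f : G -> H).
Hypothesis fM : {morph f : x y / x * y}.

Lemma morph_one : f 1 = 1.
Proof. by apply: (mulgI (f 1)); rewrite -fM !mulg1. Qed.

Lemma morph_inv x : f x^-1 = (f x)^-1.
Proof. by apply: (mulgI (f x)); rewrite -fM !mulgV morph_one. Qed.

Lemma morph_exp x n : f (x ^+ n) = f x ^+ n.
Proof. by elim: n => [|n IHn]; rewrite ?morph_one // !expgS fM IHn. Qed.

Lemma morph_kernel_subgroup : is_subgroup [set x | f x = 1].
Proof.
by split=> [|x y /= fx fy]; rewrite /= ?morph_one // fM morph_inv fx fy mulgV.
Qed.

End Morphisms.

Lemma morph_equalizer_subgroup (G H : groupType) (f g : G -> H) :
  {morph f : x y / x * y} -> {morph g : x y / x * y} ->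
  is_subgroup [set x | f x = g x].
Proof.
move=> fM gM; split=> [|x y /= fgx fgy].
  by rewrite /= (morph_one fM) (morph_one gM).
by rewrite /= fM gM (morph_inv fM) (morph_inv gM) fgx fgy.
Qed.

Lemma morph_preim_subgroup (G H : groupType) (f : G -> H) (X : set H) :
  {morph f : x y / x * y} -> is_subgroup X -> is_subgroup (f @^-1` X).
Proof.
move=> fM [X1 XV]; split=> [|x y /= Xx Xy]; first by rewrite /= (morph_one fM).
by rewrite /preimage /= fM (morph_inv fM); exact: XV.
Qed.

Lemma centralizer_subgroup (G : groupType) (z : G) :
  is_subgroup [set x | commute z x].
Proof.
split=> [|x y /= zx zy]; first exact: commute1.
by apply: commuteM => //; exact: commuteV.
Qed.

Lemma commute_conj_eq (G : groupType) (z x y : G) :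
  commute z (y^-1 * x) -> x * z * x^-1 = y * z * y^-1.
Proof.
by move=> C; apply: (mulIg x); rewrite mulgVK -!mulgA C mulgA mulVKg.
Qed.

Section Subgroups.
Variables (G : groupType) (X : set G).
Hypothesis sgX : is_subgroup X.

Lemma subgroup1 : X 1. Proof. by case: sgX. Qed.

Lemma subgroupV x : X x -> X x^-1.
Proof.
by move=> Xx; rewrite -[x^-1]mul1g; apply: (proj2 sgX) => //; case: sgX.
Qed.

Lemma subgroupM x y : X x -> X y -> X (x * y).
Proof.
by move=> Xx Xy; rewrite -[y]invgK; apply: (proj2 sgX) => //; exact: subgroupV.
Qed.

End Subgroups.

Lemma generated_min (G : groupType) (X Y : set G) :
  is_subgroup Y -> X `<=` Y -> generated X `<=` Y.
Proof. by move=> sgY XY x; apply. Qed.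

Section PresentedLift.
Variables (T : choiceType) (rels : set (seq (T * bool))).
Local Notation P := (presented_group rels).

Lemma presented_ind (X : set P) :
  is_subgroup X -> (forall v, X (pgen rels v)) -> forall x, X x.
Proof.
move=> sgX Xgen x; have [w ->] := presentedW x; elim: w => [|[v b] w IHw].
  exact: subgroup1 sgX.
rewrite -cat1s -presented_mulE; apply: (subgroupM sgX) => //.
case: b; first exact: Xgen.
have -> : \pi_P [:: (v, false)] = (pgen rels v)^-1 by rewrite [RHS]pinvE.
by apply: (subgroupV sgX).
Qed.

Section Lift.
Variables (G : groupType) (f : T -> G).

Definition letter_val (x : T * bool) : G := if x.2 then f x.1 else (f x.1)^-1.
Definition word_val (w : seq (T * bool)) : G :=
  foldr (fun x y => letter_val x * y) 1 w.

Lemma word_val_cat u w : word_val (u ++ w) = word_val u * word_val w.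
Proof. by elim: u => [|x u IHu] /=; rewrite ?mul1g // IHu mulgA. Qed.

Lemma letter_val_flip x : letter_val x * letter_val (flip x) = 1.
Proof. by case: x => v []; rewrite /letter_val /= ?mulgV ?mulVg. Qed.

Lemma word_val_comm v w : commute (f v) (f w) ->
  word_val [:: (v, true); (w, true); (v, false); (w, false)] = 1.
Proof.
move=> vw; rewrite /word_val /letter_val /= mulg1.
by rewrite mulgA vw -mulgA [X in _ * X]mulgA mulgV mul1g mulgV.
Qed.

Hypothesis frels : forall r, rels r -> word_val r = 1.

Definition pres_lift (x : P) : G := word_val (repr x).

Lemma pres_eq_val u w : pres_eq rels u w -> word_val u = word_val w.
Proof.
elim=> {u w} // [u v w _ -> _ -> //|u x w|u r w rr].
  rewrite !word_val_cat /=; congr (_ * _).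
  by rewrite mulgA letter_val_flip mul1g.
by rewrite !word_val_cat (frels rr) mul1g.
Qed.

Lemma pres_liftE w : pres_lift (\pi_P w) = word_val w.
Proof. by apply: pres_eq_val; exact: presented_repr. Qed.

Lemma pres_lift_gen v : pres_lift (pgen rels v) = f v.
Proof. by rewrite pres_liftE /= mulg1. Qed.

Lemma pres_liftM : {morph pres_lift : x y / x * y}.
Proof.
move=> x y; have [u ->] := presentedW x; have [w ->] := presentedW y.
by rewrite presented_mulE !pres_liftE word_val_cat.
Qed.

End Lift.

Lemma presented_ext (G : groupType) (f g : P -> G) :
  {morph f : x y / x * y} -> {morph g : x y / x * y} ->
  (forall v, f (pgen rels v) = g (pgen rels v)) -> f =1 g.
Proof.
move=> fM gM fg x.
exact: (presented_ind (morph_equalizer_subgroup fM gM) fg).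
Qed.

Lemma pi_word_val w : \pi_P w = word_val (pgen rels) w.
Proof.
elim: w => // [[v b] w IHw]; rewrite -cat1s -presented_mulE IHw /=.
congr (_ * _); case: b => //=.
by rewrite /letter_val /= [RHS]pinvE.
Qed.

Lemma pgen_comm v w : rels [:: (v, true); (w, true); (v, false); (w, false)] ->
  commute (pgen rels v) (pgen rels w).
Proof.
move=> r; have : \pi_P [:: (v, true); (w, true); (v, false); (w, false)] = 1.
  by apply/eq_presented; have := pres_relator [::] [::] r; rewrite cats0.
rewrite pi_word_val /word_val /letter_val /= mulg1 !mulgA.
by move=> /divg1_eq /(canRL (mulgVK _)).
Qed.

End PresentedLift.

Section SemidirectLift.
Variables (Q N H : groupType) (a : group_action Q N) (f : N -> H) (g : Q -> H).
Hypotheses (fM : {morph f : x y / x * y}) (gM : {morph g : x y / x * y}).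
Hypothesis fg : forall y x, f (a y x) = g y * f x * (g y)^-1.

Definition sdprod_lift (x : sdprod_group a) : H := f (sdl x) * g (sdr x).

Lemma sdprod_liftM : {morph sdprod_lift : x y / x * y}.
Proof.
move=> [m x] [n y]; rewrite sd_mulE /sdprod_lift /= fM gM fg !mulgA.
by rewrite mulgVK.
Qed.

End SemidirectLift.

Lemma sdprod_decomp (Q N : groupType) (a : group_action Q N)
  (x : sdprod_group a) : x = sd_inl a (sdl x) * sd_inr a (sdr x).
Proof. by case: x => n g; rewrite sd_mulE /sdmul /= gact1 mulg1 mul1g. Qed.

Lemma sd_inlM (Q N : groupType) (a : group_action Q N) :
  {morph sd_inl a : x y / x * y}.
Proof. by move=> x y; rewrite sd_mulE /sdmul /= gact1 mulg1. Qed.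

Lemma sdr_morph (Q N : groupType) (a : group_action Q N) :
  {morph @sdr Q N a : x y / x * y}.
Proof. by []. Qed.

Lemma sd_inr_act (Q N : groupType) (a : group_action Q N) (g : Q) (n : N) :
  sd_inr a g * sd_inl a n = sd_inl a (a g n) * sd_inr a g.
Proof. by rewrite !sd_mulE /sdmul /= gact1 !mulg1 !mul1g. Qed.

Lemma sdprod_torsion_free (Q N : groupType) (a : group_action Q N) :
  torsion_free Q -> torsion_free N -> torsion_free (sdprod_group a).
Proof.
move=> tfQ tfN x n n0 xn.
have x1 : sdr x = 1.
  by apply: (tfQ _ n) => //; rewrite -(morph_exp (@sdr_morph _ _ a)) xn.
have xE : x = sd_inl a (sdl x) by rewrite [LHS]sdprod_decomp x1 mulg1.
move: xn; rewrite xE -(morph_exp (@sd_inlM _ _ a)) => -[/(tfN _ _ n0) ->].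
by [].
Qed.

(** * Free groups and right-angled Artin groups are torsion-free *)

Section FreeGroup.
Variable T : choiceType.
Local Notation word := (seq (T * bool)).
Local Notation F := (presented_group (set0 : set word)).

Definition nocancel (x y : T * bool) := y != flip x.

Local Notation reduced := (sorted nocancel).

Definition push (x : T * bool) (w : word) : word :=
  if w is y :: w' then (if nocancel x y then x :: w else w') else [:: x].

Definition reduce (w : word) : word := foldr push [::] w.

Lemma push_reduced x w : reduced w -> reduced (push x w).
Proof.
case: w => //= y w; case: ifP => [xy /= -> |_]; first by rewrite xy.
exact: path_sorted.
Qed.

Lemma reduce_reduced w : reduced (reduce w).
Proof. by elim: w => //= x w; exact: push_reduced. Qed.

Lemma push_flip x w : reduced w -> push x (push (flip x) w) = w.
Proof.
rewrite /push; case: w => [|y w] /=; first by rewrite /nocancel eqxx.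
case: ifP => [_ _|]; first by rewrite /nocancel eqxx.
rewrite /nocancel flipK => /negbFE/eqP ->.
by case: w => [//|z w] /= /andP[] ->.
Qed.

(** Letters act on reduced words by [push], and a letter undoes its inverse, so
    the reduced form depends only on the element that the word represents. *)
Lemma pres_eq_reduce u w : pres_eq (set0 : set word) u w ->
  reduce u = reduce w.
Proof.
elim=> {u w} // [u v w _ -> _ -> //|u x w].
by rewrite /reduce !foldr_cat /= push_flip // reduce_reduced.
Qed.

Lemma reduce_id w : reduced w -> reduce w = w.
Proof.
elim: w => //= x w IHw xw; rewrite IHw ?(path_sorted xw) //.
by case: w xw {IHw} => //= y w /andP[->].
Qed.

Lemma reduce_pres_eq w : pres_eq (set0 : set word) (reduce w) w.
Proof.
elim: w => [|x w IHw] /=; first exact: pres_refl.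
apply: (@pres_trans _ _ _ (x :: reduce w)); last exact: (pres_catl [:: x]).
rewrite /push; case: (reduce w) => [|y u]; first exact: pres_refl.
rewrite /nocancel; case: eqP => [->|_] /=; last exact: pres_refl.
by apply: pres_sym; exact: (pres_cancel _ [::] x u).
Qed.

Lemma reduced_pow x w n : reduced (x :: w) -> nocancel (last x w) x ->
  reduced (flatten (nseq n (x :: w))).
Proof.
move=> rxw xx; suff path_pow z : nocancel z x ->
    path nocancel z (flatten (nseq n (x :: w))).
  by apply: (@path_sorted _ _ x); apply: path_pow; case: x {rxw xx} => v [];
    rewrite /nocancel /flip xpair_eqE /= andbF.
elim: n z => //= n IHn z zx; rewrite zx cat_path.
by rewrite [path _ _ _]rxw IHn.
Qed.

Lemma pi_flatten_nseq w n : \pi_F (flatten (nseq n w)) = (\pi_F w) ^+ n.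
Proof. by elim: n => // n IHn; rewrite expgS -IHn presented_mulE. Qed.

(** A power of a cyclically reduced word is reduced, and every element is
    conjugate to one that is represented by a cyclically reduced word. *)
Lemma free_torsion_free : torsion_free F.
Proof.
move=> x n n0; have [w ->] := presentedW x.
have /eq_presented <- := reduce_pres_eq w.
move: (reduce_reduced w); move: (reduce w) => {w x}w.
have [m] := ubnP (size w); elim: m w => // m IHm [//|x w] /ltnSE szw rw wn.
have [xx|] := boolP (nocancel (last x w) x).
  move: wn; rewrite -pi_flatten_nseq => /eq_presented /pres_eq_reduce.
  by rewrite reduce_id ?reduced_pow //; case: (n) n0.
rewrite negbK => /eqP xlast.
case/lastP: w szw rw wn xlast => [_ _ _ /= xx|u y].
  by case: x xx => v [].
rewrite [size _]/= size_rcons [last _ _]/= last_rcons => szw + + xE; rewrite xE.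
rewrite [sorted _ _]/= rcons_path => /andP[ru uy] wn.
suff /eq_presented u1 : \pi_F u = \pi_F [::].
  move: u1 => /pres_eq_reduce; rewrite reduce_id ?(path_sorted ru) //.
  by move=> /= u1; move: uy; rewrite u1 /= /nocancel flipK eqxx.
have E : \pi_F (flip y :: rcons u y) =
    (\pi_F [:: y])^-1 * \pi_F u * \pi_F [:: y].
  have -> : (\pi_F [:: y])^-1 = \pi_F [:: flip y] by rewrite [LHS]pinvE.
  by rewrite (presented_mulE _ [:: flip y] u) presented_mulE cats1.
apply: IHm; rewrite ?(path_sorted ru) //; first exact: ltnW.
apply: (mulgI (\pi_F [:: y])^-1); apply: (mulIg (\pi_F [:: y])).
rewrite mulg1 mulVg -wn E; move: (\pi_F u) (\pi_F [:: y]) => a b.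
by elim: (n) => [|k IHk]; rewrite ?mulg1 ?mulVg // !expgS -IHk !mulgA mulgK.
Qed.

End FreeGroup.

Lemma raag_relsP (K : simplicial_complex) (G : groupType) (f : K -> G) :
  (forall v w, edge v w -> commute (f v) (f w)) ->
  forall r, raag_rels K r -> word_val f r = 1.
Proof. by move=> fC r [v [w [/fC vw ->]]]; exact: word_val_comm. Qed.

Section RaagTorsion.
Variable K : simplicial_complex.
Implicit Types (U : seq K) (v w : K).

Lemma edge_comm v w : edge v w -> commute (raag_gen v) (raag_gen w).
Proof. by move=> vw; apply: pgen_comm; exists v, w. Qed.

(** Killing the letters outside [U] presents the Artin group of the full
    subgraph on [U] over the unchanged alphabet [K]. *)
Definition killed_rels U : set (seq (K * bool)) :=
  raag_rels K `|` [set [:: (v, true)] | v in [set v | v \notin U]].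

Local Notation A U := (presented_group (killed_rels U)).
Local Notation gen U := (pgen (killed_rels U)).

Lemma gen_killed U v : v \notin U -> gen U v = 1.
Proof.
move=> vU; apply/eq_presented.
have r : killed_rels U [:: (v, true)] by right; exists v.
exact: (pres_relator [::] [::] r).
Qed.

Lemma killed_comm U v w : edge v w -> commute (gen U v) (gen U w).
Proof. by move=> vw; apply: pgen_comm; left; exists v, w. Qed.

Lemma killed_relsP (G : groupType) (f : K -> G) U :
  (forall v w, edge v w -> commute (f v) (f w)) ->
  (forall v, v \notin U -> f v = 1) ->
  forall r, killed_rels U r -> word_val f r = 1.
Proof.
move=> fC f1 r [[v [w [/fC vw ->]]]|[v /= vU <-]]; first exact: word_val_comm.
by rewrite /word_val /letter_val /= f1 // mulg1.
Qed.

Section AddVertex.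
Variables (U : seq K) (v : K).

Local Notation B := (A U).
Local Notation B' := (A (v :: U)).
Local Notation F := (presented_group (set0 : set (seq (set B * bool)))).

Let link : set B := generated [set gen U w | w in [set w | edge v w]].

(** Left translates of subsets: the free generators below are all subsets of [B],
   of which only the left cosets of [link] matter. *)
Let tr (b : B) (Z : set B) : set B := [set y | Z (b^-1 * y)].

Let trM b c Z : tr (b * c) Z = tr b (tr c Z).
Proof. by apply/funext => y; rewrite /tr /= invgM mulgA. Qed.

Let tr1 Z : tr 1 Z = Z.
Proof. by apply/funext => y; rewrite /tr /= invg1 mul1g. Qed.

Let act (b : B) (x : F) : F := presented_map set0 (tr b) x.

Let actE b (s : seq (set B * bool)) :
  act b (\pi_F s) = \pi_F (word_map (tr b) s).
Proof. exact: presented_mapE. Qed.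

Let act1 x : act 1 x = x.
Proof.
have [w ->] := presentedW x; rewrite actE; congr (\pi_F _).
by rewrite /word_map map_id_in // => -[Z b] _ /=; rewrite tr1.
Qed.

Let actM b c x : act (b * c) x = act b (act c x).
Proof.
have [w ->] := presentedW x; rewrite (actE c) !actE; congr (\pi_F _).
by rewrite /word_map -map_comp; apply: eq_map => -[Z d] /=; rewrite trM.
Qed.

Let act_mul b x y : act b (x * y) = act b x * act b y.
Proof. exact: presented_mapM. Qed.

Let action := GroupAction act1 actM act_mul.
Let W := sdprod_group action.

Let act_gen b Z : act b (pgen set0 Z) = pgen set0 (tr b Z).
Proof. exact: actE. Qed.

Let to_gen w : W :=
  if w == v then sd_inl action (pgen set0 link) else sd_inr action (gen U w).

Let to_gen_link w : edge v w -> commute (to_gen v) (to_gen w).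
Proof.
move=> vw; rewrite /to_gen eqxx eq_sym (negbTE (proj1 vw)); apply: commute_sym.
rewrite /commute sd_inr_act /= act_gen; congr (sd_inl _ (pgen _ _) * _).
have sg := generated_subgroup [set gen U w | w in [set w | edge v w]].
have lw : link (gen U w) by apply: sub_generated; exists w.
apply/seteqP; split=> y /= ly; last first.
  by apply: (subgroupM sg) => //; exact: (subgroupV sg).
by rewrite -[y](mulVKg (gen U w)); exact: (subgroupM sg).
Qed.

Let to_rels r : killed_rels (v :: U) r -> word_val to_gen r = 1.
Proof.
apply: killed_relsP => [u w uw|w].
  have [uv|uv] := eqVneq u v; first by move: uw; rewrite uv; exact: to_gen_link.
  have [wv|wv] := eqVneq w v.
    by move/edge_sym: uw; rewrite wv => /to_gen_link/commute_sym.
  rewrite /to_gen (negbTE uv) (negbTE wv) /commute -!sd_inrM.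
  by rewrite (killed_comm U uw).
rewrite inE negb_or => /andP[wv wU].
by rewrite /to_gen (negbTE wv) gen_killed.
Qed.

Let incl_gen w : B' := if w \in U then gen (v :: U) w else 1.

Let incl_rels r : killed_rels U r -> word_val incl_gen r = 1.
Proof.
apply: killed_relsP => [u w uw|w /negbTE wU]; rewrite /incl_gen ?wU //.
case: ifP => _; last exact/commute_sym/commute1.
by case: ifP => _; [exact: killed_comm|exact: commute1].
Qed.

Let incl : B -> B' := pres_lift incl_gen.
Let inclM : {morph (incl : B -> B') : x y / x * y} := pres_liftM incl_rels.

Let incl_link c : link c -> commute (gen (v :: U) v) (incl c).
Proof.
apply: (generated_min (morph_preim_subgroup inclM (centralizer_subgroup _))).
move=> _ [w /= vw <-]; rewrite /preimage /= /incl (pres_lift_gen incl_rels) /incl_gen.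
by case: ifP => _; [exact: killed_comm|exact: commute1].
Qed.

Let coset_val (b : B) : B' := incl b * gen (v :: U) v * (incl b)^-1.

Let from_gen (Z : set B) : B' :=
  if pselect (exists b, Z = tr b link) is left ex then coset_val (sval (cid ex))
  else 1.

Let from_gen_coset b : from_gen (tr b link) = coset_val b.
Proof.
rewrite /from_gen; case: pselect => [ex|[]]; last by exists b.
case: (cid ex) => b' /= bb'; rewrite /coset_val.
have : tr b link b'.
  rewrite bb' /tr /= mulVg.
  exact: subgroup1 (generated_subgroup _).
move=> /incl_link; rewrite inclM (morph_inv inclM) => C.
exact: commute_conj_eq.
Qed.

Let from_gen_tr b Z : from_gen (tr b Z) = incl b * from_gen Z * (incl b)^-1.
Proof.
have [[c ->]|ex] := pselect (exists c, Z = tr c link).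
  by rewrite -trM !from_gen_coset /coset_val inclM invgM !mulgA.
rewrite /from_gen; case: pselect => [E|_].
  have [c Zc] := E; case: ex; exists (b^-1 * c).
  by rewrite trM -Zc -trM mulVg tr1.
by case: pselect => // _; rewrite mulg1 mulgV.
Qed.

Let from_rels r : (set0 : set (seq (set B * bool))) r -> word_val from_gen r = 1.
Proof. by []. Qed.

Let fromF : F -> B' := pres_lift from_gen.
Let fromFM : {morph (fromF : F -> B') : x y / x * y} := pres_liftM from_rels.

Let fromF_act b x : fromF (action b x) = incl b * fromF x * (incl b)^-1.
Proof.
move: x; apply: presented_ext => [x y|x y|Z].
- by rewrite /= act_mul fromFM.
- by rewrite fromFM !mulgA mulgVK.
- by rewrite /= act_gen /fromF !(pres_lift_gen from_rels) from_gen_tr.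
Qed.

(** For [v] outside [U], the new group is the extension of [B] by a letter [v]
    that commutes with the subgroup [link]. In it the conjugates [b v b^-1]
    depend only on the coset [b link] and generate freely, so it embeds in the
    semidirect product of the free group on the cosets with [B]; a left inverse
    of the embedding sends the generator [b link] back to [b v b^-1]. *)
Lemma killed_torsion_free_step : torsion_free B -> torsion_free B'.
Proof.
move=> tfB x n n0 xn.
pose to := pres_lift to_gen : B' -> W.
have toM : {morph to : x y / x * y} := pres_liftM to_rels.
pose from := sdprod_lift fromF incl : W -> B'.
have fromM : {morph from : x y / x * y} := sdprod_liftM fromFM inclM fromF_act.
have toK : cancel to from.
  apply: presented_ext => // [y z|w]; first by rewrite toM fromM.
  rewrite /to (pres_lift_gen to_rels) /to_gen; case: eqVneq => [->|wv].
    rewrite /from /sdprod_lift /= (morph_one inclM) mulg1.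
    rewrite /fromF (pres_lift_gen from_rels) -(tr1 link) from_gen_coset /coset_val.
    by rewrite (morph_one inclM) invg1 mulg1 mul1g.
  rewrite /from /sdprod_lift /= (morph_one fromFM) mul1g.
  rewrite /incl (pres_lift_gen incl_rels) /incl_gen; case: ifPn => // wU.
  by rewrite gen_killed // inE negb_or wv.
apply: (can_inj toK); rewrite (morph_one toM).
have tfW : torsion_free W.
  by apply: sdprod_torsion_free => //; exact: free_torsion_free.
by apply: tfW n0 _; rewrite -(morph_exp toM) xn (morph_one toM).
Qed.

End AddVertex.

Lemma killed_torsion_free U : torsion_free (A U).
Proof.
elim: U => [|v U]; last exact: killed_torsion_free_step.
move=> x _ _ _; move: x; apply: presented_ext => [//|y z|v].
  by rewrite mulg1.
exact: gen_killed.
Qed.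

(** A word involves only finitely many letters [U], and the Artin group of the
    full subgraph on [U] is a retract. *)
Lemma raag_torsion_free : torsion_free (raag K).
Proof.
move=> x n n0 xn; have [w xw] := presentedW x.
pose U := map fst w.
have fromr r : raag_rels K r -> word_val (gen U) r = 1.
  by apply: raag_relsP; exact: killed_comm.
pose g v : raag K := if v \in U then raag_gen v else 1.
have gr r : killed_rels U r -> word_val g r = 1.
  apply: killed_relsP => [u v uv|v /negbTE]; rewrite /g; last by move=> ->.
  case: ifP => _; last exact/commute_sym/commute1.
  by case: ifP => _; [exact: edge_comm|exact: commute1].
have h1 : pres_lift (gen U) x = 1 :> A U.
  apply: (killed_torsion_free n0).
  by rewrite -(morph_exp (pres_liftM fromr)) xn (morph_one (pres_liftM fromr)).
have : pres_lift g (pres_lift (gen U) x) = x.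
  rewrite xw (pres_liftE fromr) -pi_word_val (pres_liftE gr) pi_word_val.
  have : {subset map fst w <= U} by [].
  elim: (w) => //= -[v b] s IHs sU; rewrite IHs; last first.
    by move=> u us; apply: sU; rewrite inE us orbT.
  by rewrite /letter_val /g /= sU ?inE ?eqxx.
by rewrite h1 => <-; exact: morph_one (pres_liftM gr).
Qed.

End RaagTorsion.

(** * Vertices of a covering complex *)

Section Toward.
Local Open Scope ring_scope.
Variables (R : realType) (K : simplicial_complex).
Implicit Types (v w u : K) (l : seq K) (s : {fset K}) (x : realization R K).

(** For small [d > 0], these are the barycentric coordinates of a point near
    [v] in the interior of the simplex spanned by [v] and [l]. *)
Definition toward v l (d : R) : K -> R :=
  fun u => (u == v)%:R * (1 - d *+ size l) + \sum_(w <- l) (u == w)%:R * d.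

Lemma toward_simplex s v l d : v \in s -> {subset l <= s} ->
  0 <= d -> d *+ size l <= 1 -> closed_simplex s (toward v l d).
Proof.
move=> vs ls d0 d1; split=> [u|u us|]; rewrite /toward.
- rewrite addr_ge0 ?mulr_ge0 ?ler0n ?subr_ge0 //.
  by apply: sumr_ge0 => w _; rewrite mulr_ge0.
- have /negbTE -> : u != v by apply: contraNneq us => ->.
  rewrite mul0r add0r big_seq big1 // => w /ls ws.
  by have /negbTE -> : u != w; [apply: contraNneq us => ->|rewrite mul0r].
- rewrite big_split /= big_delta ?fset_uniq // mul1r exchange_big /=.
  rewrite (eq_big_seq (fun=> d)) => [|w /ls ws].
    by rewrite big_const_seq count_predT iter_addr_0 subrK.
  by rewrite big_delta ?fset_uniq // mul1r.
Qed.

Lemma toward_gt0 v l d u : 0 < d -> d *+ size l <= 1 -> u \in l ->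
  0 < toward v l d u.
Proof.
move=> d0 d1 ul; rewrite ltr_wpDl ?mulr_ge0 ?ler0n ?subr_ge0 //.
rewrite (big_rem u) //= eqxx mul1r ltr_wpDr //.
by apply: sumr_ge0 => w _; rewrite mulr_ge0 // ltW.
Qed.

Lemma toward_near (O : set (realization R K)) s v l : open O -> O (vtx R v) ->
  simplex s -> v \in s -> {subset l <= s} ->
  exists2 d0 : R, 0 < d0 & forall d, 0 < d <= d0 ->
    d *+ size l <= 1 /\ forall x, x =1 toward v l d -> O x.
Proof.
move=> + Ov ss vs ls; rewrite realization_openE => oO.
have sv : closed_simplex s (vtx R v).
  have -> : (vtx R v : K -> R) = toward v [::] 0.
    by apply/funext => u; rewrite /= /vtx_fun /toward big_nil addr0 subr0 mulr1.
  by apply: toward_simplex; rewrite ?mulr0n ?ler01.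
have [e e0 eO] := oO s _ ss sv Ov.
pose n := size l; pose d0 : R := Num.min e 1 / (n.+1.*2)%:R.
have m0 : 0 < Num.min e 1 by rewrite lt_min e0 ltr01.
exists d0 => [|d /andP[d_gt0 dd0]]; first by rewrite divr_gt0 // ltr0n.
have dn : (d *+ n) *+ 2 < Num.min e 1.
  rewrite -mulrnA muln2; move: dd0; rewrite ler_pdivlMr ?ltr0n // mulr_natr.
  by apply: lt_le_trans; rewrite ltr_pMn2l // ltn_double.
have dn0 : 0 <= d *+ n by rewrite mulrn_wge0 // ltW.
split=> [|x xE].
  apply/ltW/(le_lt_trans (y := (d *+ n) *+ 2)); first by rewrite mulr2n lerDl.
  by apply: lt_le_trans dn _; rewrite ge_min lexx orbT.
apply: eO => [|u us].
  have -> : (x : K -> R) = toward v l d by apply/funext.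
  apply: toward_simplex; rewrite ?(ltW d_gt0) //.
  apply/ltW/(le_lt_trans (y := (d *+ n) *+ 2)); first by rewrite mulr2n lerDl.
  by apply: lt_le_trans dn _; rewrite ge_min lexx orbT.
rewrite xE /= /vtx_fun /toward.
set S := \sum_(w <- l) _.
have S0 : 0 <= S by apply: sumr_ge0 => w _; rewrite mulr_ge0 // ltW.
have Sn : S <= d *+ n.
  rewrite /S -/n; have -> : d *+ n = \sum_(w <- l) d.
    by rewrite big_const_seq count_predT iter_addr_0.
  by apply: ler_sum => w _; case: eqP => _; rewrite ?mul1r ?mul0r // ltW.
have b0 : 0 <= (u == v)%:R * (d *+ n) by rewrite mulr_ge0.
have bn : (u == v)%:R * (d *+ n) <= d *+ n.
  by case: eqP => _; rewrite ?mul1r ?mul0r.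
rewrite mulrBr mulr1 opprD opprB addrA (addrC _%:R) subrK.
apply: (@le_lt_trans _ _ (d *+ n *+ 2)); last first.
  by apply: lt_le_trans dn _; rewrite ge_min lexx.
rewrite (le_trans (ler_normB _ _)) // !ger0_norm //.
by rewrite mulr2n lerD.
Qed.

Lemma toward_point s v l (d : R) : simplex s -> v \in s -> {subset l <= s} ->
  0 <= d -> d *+ size l <= 1 -> exists x, x =1 toward v l d.
Proof.
move=> ss vs ls d0 d1.
by exists (Realization (ex_intro2 _ _ s ss (toward_simplex vs ls d0 d1))).
Qed.

End Toward.

Section CoveringVertices.
Local Open Scope ring_scope.
Variables (R : realType) (M L : simplicial_complex).
Variable p : simplicial_covering R M L.
Local Notation rp := (realize R p).
Implicit Types (v w : M) (x : realization R M) (g h : deck_group p).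

Lemma realize_toward x (s : {fset M}) v (l : seq M) (d : R) :
  v \in s -> {subset l <= s} -> 0 <= d -> d *+ size l <= 1 -> x =1 toward v l d ->
  rp x =1 toward (p v) (map p l) d.
Proof.
move=> vs ls d0 d1 xE u.
have sx : closed_simplex s x.
  have -> : (x : M -> R) = toward v l d by apply/funext.
  exact: toward_simplex.
rewrite /= (realize_funE p u sx); under eq_bigr do rewrite xE.
rewrite /toward big_split /= big_delta ?fset_uniq // size_map eq_sym.
congr (_ + _); rewrite exchange_big /= big_map.
apply: eq_big_seq => w /ls ws.
by rewrite big_delta ?fset_uniq // eq_sym.
Qed.

Lemma edge_proj v w : edge v w -> edge (p v) (p w).
Proof.
move=> vw; split.
  apply/eqP => pvw; have /eqP := proj1 vw; apply.
  apply: (covering_supp_inj (p := p) (x := seg vw 2^-1)) pvw;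
    by rewrite seg_half eqxx ?orbT mul1r invr_neq0 // pnatr_eq0.
by have := smap_simplex p (proj2 vw); rewrite imfset_fset2.
Qed.

(** Otherwise two points near [v] on the edges [v w] and [v w'] have the same
    image, contradicting local injectivity. *)
Lemma star_inj v w w' : edge v w -> edge v w' -> p w = p w' -> w = w'.
Proof.
move=> vw vw' pww'.
have [W [oW Wv] Winj] := covering_locally_injective (vtx R v) (cov_covering p).
have vs u : v \in [fset v; u]%fset by rewrite !inE eqxx.
have ls u : {subset [:: u] <= [fset v; u]%fset}.
  by move=> z; rewrite !inE orbC => ->.
have [d1 d10 near1] := toward_near oW Wv (proj2 vw) (vs w) (ls w).
have [d2 d20 near2] := toward_near oW Wv (proj2 vw') (vs w') (ls w').
pose d := Num.min d1 d2.
have d0 : 0 < d by rewrite lt_min d10.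
have [|b1 W1] := near1 d; first by rewrite d0 ge_min lexx.
have [|b2 W2] := near2 d; first by rewrite d0 ge_min lexx orbT.
have [x xE] := toward_point (proj2 vw) (vs w) (ls w) (ltW d0) b1.
have [y yE] := toward_point (proj2 vw') (vs w') (ls w') (ltW d0) b2.
have : x = y.
  apply: Winj; rewrite ?inE; [exact: W1|exact: W2|].
  apply: bary_inj => u.
  rewrite (realize_toward (vs w) (ls w) (ltW d0) b1 xE).
  by rewrite (realize_toward (vs w') (ls w') (ltW d0) b2 yE) /= pww'.
have wv : (w == v) = false by rewrite eq_sym (negbTE (proj1 vw)).
move=> /(congr1 (fun z : realization R M => z w)); rewrite xE yE /toward.
rewrite !big_seq1 wv eqxx !mul0r !add0r mul1r; case: eqVneq => // _ /eqP.
by rewrite mul0r gt_eqF.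
Qed.

(** Sheets are open, so the image of the open star of [v] contains points near
    [p v] in every simplex at [p v]; a preimage spans the lifted simplex. *)
Lemma star_lift v (s : {fset L}) (l : seq L) :
  simplex s -> p v \in s -> {subset l <= s} ->
  exists2 x : realization R M,
    x v != 0 & forall u, u \in l -> exists2 w, x w != 0 & p w = u.
Proof.
move=> ss vs ls.
have [_ _ /(_ (rp (vtx R v)))[U [[oU Uv] [I [W [oW _ pU pW]]]]]] := cov_covering p.
have : (rp @^-1` U) (vtx R v) by [].
rewrite pU => -[i _ Wv].
have [_ openW] := pW i.
pose O := W i `&` [set x : realization R M | x v != 0].
have oO : open O.
  apply: openI => //; apply: (@open_comp _ _ (fun x => x v) [set r : R | r != 0]).
    by move=> x _; exact: bary_continuous.
  exact: open_neq.
have Ov : (rp @` O) (vtx R (p v)).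
  exists (vtx R v); last exact: realize_vtx.
  by split=> //=; rewrite /vtx_fun eqxx oner_eq0.
have oP : open (rp @` O) by apply: openW => // x [].
have [d d0 /(_ d)[|b near]] := toward_near oP Ov ss vs ls; first by rewrite d0 lexx.
have [y yE] := toward_point ss vs ls (ltW d0) b.
have [x [Wx xv] xy] := near _ yE; exists x => // u ul.
have := toward_gt0 (p v) d0 b ul; rewrite -yE -xy => u0.
apply: contrapT => nw; move: u0.
have [t _ tx] := baryP x; rewrite /= (realize_funE p u tx) big1 ?ltxx // => w /eqP pw.
by apply/eqP; apply: contrapT => /negP xw; apply: nw; exists w.
Qed.

Lemma edge_lift v u : edge (p v) u -> exists2 w, edge v w & p w = u.
Proof.
move=> vu; have [||x xv /(_ u)[|w xw pw]] := @star_lift v _ [:: u] (proj2 vu).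
- by rewrite !inE eqxx.
- by move=> z; rewrite !inE orbC => ->.
- exact: mem_head.
exists w => //; split; last exact: bary_supp_simplex xv xw.
by apply: contra_neq (proj1 vu) => ->.
Qed.

(** In a flag complex the triangle [p v], [p w], [p w'] spans a simplex. It lifts
    to a simplex at [v], whose other vertices are [w] and [w'] by uniqueness. *)
Lemma link_edge v w w' : flag L -> edge v w -> edge v w' ->
  edge (p w) (p w') -> edge w w'.
Proof.
move=> flagL vw vw' ww'.
have pvw := edge_proj vw; have pvw' := edge_proj vw'.
pose s := [fset p v; p w; p w']%fset.
have ss : simplex s.
  apply: flagL; first by apply/fset0Pn; exists (p v); rewrite !inE eqxx.
  move=> a b; rewrite !inE => /orP[/orP[]|] /eqP -> /orP[/orP[]|] /eqP ->;
    rewrite ?eqxx // => _ //; exact: edge_sym.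
have [||x xv xl] := @star_lift v s [:: p w; p w'] ss.
- by rewrite !inE eqxx.
- by move=> z; rewrite !inE => /orP[] ->; rewrite ?orbT.
have lift_eq u : edge v u -> p u \in [:: p w; p w'] -> x u != 0.
  move=> vu /xl[z xz pz]; rewrite -(star_inj _ vu pz) //.
  split; last exact: bary_supp_simplex xv xz.
  by apply: contra_neq (proj1 (edge_proj vu)) => ->.
have xw : x w != 0 by apply: lift_eq => //; rewrite inE eqxx.
have xw' : x w' != 0 by apply: lift_eq => //; rewrite !inE eqxx orbT.
split; last exact: bary_supp_simplex xw xw'.
by apply: contra_neq (proj1 ww') => ->.
Qed.

Lemma proj_vertex_surj (u : L) : exists v, p v = u.
Proof.
have [_ + _] := cov_covering p => /(_ (vtx R u) I)[x _ xu].
have [v xv] := bary_supp_neq0 x; exists v; apply/eqP.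
have := covering_coord p xv; rewrite xu /= /vtx_fun.
by case: eqP => // _ /esym/eqP; rewrite (negbTE xv).
Qed.

Lemma deck_act_transitive v w : regular_covering rp -> p v = p w ->
  exists g, deck_act g v = w.
Proof.
move=> [_ reg] pvw; have [|g gv] := reg (vtx R v) (vtx R w).
  by rewrite !realize_vtx pvw.
by exists g; apply: (@vtx_inj R); rewrite -deck_actE.
Qed.

(** On a connected total space a deck transformation with a fixed point is the
    identity: over an evenly covered set it either fixes a sheet pointwise or
    moves it off itself, so the set of fixed points is open and closed. *)
Lemma deck_fixed_point g x0 : connected_complex R M -> g x0 = x0 -> g = 1%g.
Proof.
move=> connM gx0.
have local x : exists V, open_nbhs x V /\ forall y, V y -> (g x = x <-> g y = y).
  have [_ _ /(_ (rp x))[U [[oU Ux] [J [W [oW tW pU pW]]]]]] := cov_covering p.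
  have : (rp @^-1` U) x by [].
  rewrite pU => -[i _ Wx].
  have : (rp @^-1` U) (g x) by rewrite /preimage /= deck_over.
  rewrite pU => -[j _ Wgx].
  have Winj y : W i y -> W i (g y) -> g y = y.
    by move=> Wy Wgy; have [[_ + _] _] := pW i; apply; rewrite ?inE // deck_over.
  exists (W i `&` g @^-1` W j); split; first split.
  - apply: openI => //; apply: open_comp => // z _; exact: deck_continuous.
  - by split.
  - have same z : W i z -> W j (g z) -> g z = z -> i = j.
      move=> Wz Wgz fixed; apply: (tW i j I I); exists z; split; first exact: Wz.
      by have := Wgz; rewrite fixed.
    have moved z : i = j -> W i z -> W j (g z) -> g z = z.
      by move=> ij; rewrite -ij; exact: Winj.
    move=> y [Wy Wgy]; split=> fixed.
      exact: (moved y (same x Wx Wgx fixed) Wy Wgy).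
    exact: (moved x (same y Wy Wgy fixed) Wx Wgx).
pose E := [set x | g x = x].
have oE : open E.
  rewrite openE => x gx; have [V [oV VE]] := local x.
  have : nbhs x V by exact: open_nbhs_nbhs.
  by apply: filterS => y Vy; apply/(VE y Vy).
have cE : closed E.
  rewrite -[E]setCK; apply: open_closedC; rewrite openE => x gx.
  have [V [oV VE]] := local x.
  have : nbhs x V by exact: open_nbhs_nbhs.
  by apply: filterS => y Vy; rewrite /setC /E /= -(VE y Vy).
have ET : E = setT.
  apply: connM; first by exists x0.
    by exists E => //; rewrite setTI.
  by exists E => //; rewrite setTI.
apply: deck_eq => x; have : E x by rewrite ET.
by [].
Qed.

Lemma deck_act_free g v : connected_complex R M -> deck_act g v = v -> g = 1%g.
Proof.
move=> connM gv; apply: (deck_fixed_point (x0 := vtx R v)) => //.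
by rewrite deck_actE gv.
Qed.

End CoveringVertices.

(** * Commutants in a coinduced group *)

Section FunctionGroup.
Variables (X : Type) (G : groupType).

Definition fun_group := X -> G.
HB.instance Definition _ := gen_eqMixin fun_group.
HB.instance Definition _ := gen_choiceMixin fun_group.

Let fmul (f g : fun_group) : fun_group := fun x => f x * g x.
Let fone : fun_group := fun=> 1.
Let finv (f : fun_group) : fun_group := fun x => (f x)^-1.
Let fmulA : associative fmul.
Proof. by move=> f g h; apply/funext => x; rewrite /fmul mulgA. Qed.
Let fmul1 : left_id fone fmul.
Proof. by move=> f; apply/funext => x; rewrite /fmul mul1g. Qed.
Let fmulr1 : right_id fone fmul.
Proof. by move=> f; apply/funext => x; rewrite /fmul mulg1. Qed.
Let fmulV : left_inverse fone finv fmul.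
Proof. by move=> f; apply/funext => x; rewrite /fmul mulVg. Qed.
Let fmulrV : right_inverse fone finv fmul.
Proof. by move=> f; apply/funext => x; rewrite /fmul mulgV. Qed.

HB.instance Definition _ := isGroup.Build fun_group fmulA fmul1 fmulr1 fmulV fmulrV.

End FunctionGroup.

(** The group [G] acts on the functions [A -> G] through [q], by left
    translations of [A]; a subgroup that embeds in [A] acts by a coinduced
    module. *)
Section Coinduced.
Variables (G A : groupType) (q : G -> A).
Hypothesis qM : {morph q : x y / x * y}.

Let act (g : G) (f : fun_group A G) : fun_group A G := fun x => f ((q g)^-1 * x).

Let act1 f : act 1 f = f.
Proof. by apply/funext => x; rewrite /act (morph_one qM) invg1 mul1g. Qed.
Let actM g h f : act (g * h) f = act g (act h f).
Proof. by apply/funext => x; rewrite /act qM invgM mulgA. Qed.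
Let act_mul g (f f' : fun_group A G) : act g (f * f') = act g f * act g f'.
Proof. by []. Qed.

Definition coind_action := GroupAction act1 actM act_mul.
Definition coind := sdprod_group coind_action.
HB.instance Definition _ := Group.on coind.

Definition coind_val (y : coind) : A -> G := sdl y.

Implicit Types (y z : coind).

Lemma coind_valM y z x :
  coind_val (y * z) x = coind_val y x * coind_val z ((q (sdr y))^-1 * x).
Proof. by []. Qed.

Lemma coind_valV y x : coind_val y^-1 x = (coind_val y (q (sdr y) * x))^-1.
Proof.
by rewrite /coind_val /inv /= /sdinv /= /act (morph_inv qM) invgK.
Qed.

Lemma coind_eq y z : sdr y = sdr z -> coind_val y =1 coind_val z -> y = z.
Proof.
by case: y z => [f g] [f' g'] /= -> ff'; congr Sdprod; apply/funext.
Qed.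

(** The two lifts [d |-> r d] and [d |-> t * r d * t^-1] of [D] differ by a
    cocycle with values in a coinduced module, because [D] acts freely on [A];
    such a cocycle is a coboundary, which corrects [t]. Concretely, the first
    coordinate is [t] at one point of each [D]-orbit of [A] and is determined
    elsewhere. *)
Lemma coind_commutant (D : set A) (r : A -> coind) (t : G) :
    is_subgroup D -> {morph r : x y / x * y} ->
    (forall c, D c -> q (sdr (r c)) = c) ->
    (forall c, D c -> commute t (sdr (r c))) ->
  exists y : coind, [/\ sdr y = t, forall c, D c -> commute y (r c) &
    forall x, exists2 d, D d &
      coind_val y x = coind_val (r d) x * t * (coind_val (r d) ((q t)^-1 * x))^-1].
Proof.
move=> sgD rM rq rt.
pose rep (x : A) : A := xget 1 [set z | D (x * z^-1)].
have repD x : D (x * (rep x)^-1).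
  apply: (@xgetPex _ 1 [set z | D (x * z^-1)]); exists x.
  by rewrite /= mulgV; exact: subgroup1 sgD.
have rep_orbit c x : D c -> rep (c^-1 * x) = rep x.
  move=> Dc; congr xget; apply/funext => z; apply/propext; split=> /= Dz.
    by rewrite -[x](mulVKg c) -mulgA; exact: (subgroupM sgD).
  by rewrite -mulgA; apply: (subgroupM sgD) => //; exact: (subgroupV sgD).
pose d x := x * (rep x)^-1.
pose th : fun_group A G :=
  fun x => coind_val (r (d x)) x * t * (coind_val (r (d x)) ((q t)^-1 * x))^-1.
exists (Sdprod coind_action th t); split=> // [c Dc|x].
  2: by exists (d x); first exact: repD.
apply: coind_eq => [|x]; first exact: rt.
rewrite !coind_valM /= rq // {1 2}/coind_val /= /th.
have -> : d x = c * d (c^-1 * x) by rewrite /d rep_orbit // !mulgA mulgV mul1g.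
have tc : commute (q t)^-1 c^-1.
  apply/commuteV/commute_sym/commuteV/commute_sym.
  by have := rt c Dc => /(congr1 q); rewrite !qM rq.
rewrite rM !coind_valM rq // invgM !mulgA mulgVK.
by rewrite -(mulgA _ (q t)^-1) tc !mulgA.
Qed.

End Coinduced.

(** * Conjugates of the deck group and the projection to [A_L] *)

Section Conjugates.
Variables (R : realType) (M L : simplicial_complex).
Variable p : simplicial_covering R M L.

Local Notation Gamma := (raag_deck p).
Local Notation inl := (sd_inl (raag_action p)).
Local Notation inr := (sd_inr (raag_action p)).

(** This is [N(T)], as a subgroup of the whole of [A_M x| pi]. *)
Definition conj_deck (T : set int) : set Gamma :=
  generated [set y | exists b g, T (ht b) /\ y = inl b * inr g * (inl b)^-1].

Lemma conj_deck_subgroup T : is_subgroup (conj_deck T).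
Proof. exact: generated_subgroup. Qed.

(** Conjugation by [x] shifts the heights by the height of [x]. *)
Lemma conj_deck_conj (T T' : set int) (x y : Gamma) :
  (forall n, T n -> T' (ht (sdl x) + n)%R) ->
  conj_deck T y -> conj_deck T' (x * y * x^-1).
Proof.
move=> TT'; have conjM : {morph (fun z : Gamma => x * z * x^-1) : y z / y * z}.
  by move=> z z'; rewrite !mulgA mulgVK.
apply: (generated_min (morph_preim_subgroup conjM (conj_deck_subgroup T'))).
move=> _ [b [g [Tb ->]]]; apply: sub_generated.
exists (sdl x * raag_act (sdr x) b), (sdr x * g * (sdr x)^-1).
split; last exact: sd_conj.
by rewrite htM ht_act; exact: TT'.
Qed.

Lemma conj_deck_inr (T : set int) g : T 0%R -> conj_deck T (inr g).
Proof.
move=> T0; apply: sub_generated; exists 1, g; rewrite ht1; split=> //.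
have -> : inl 1 = 1 by exact: morph_one (@sd_inlM _ _ _).
by rewrite invg1 mul1g mulg1.
Qed.

Lemma conj_deck_height (T : set int) x : conj_deck T x -> ht (sdl x) = 0%R.
Proof.
have htMM (y z : Gamma) : ht (sdl (y * z)) = (ht (sdl y) + ht (sdl z))%R.
  by rewrite htM ht_act.
have ht1' : ht (sdl (1 : Gamma)) = 0%R by exact: ht1.
have htVV (y : Gamma) : ht (sdl y^-1) = (- ht (sdl y))%R.
  by apply/eqP; rewrite -addr_eq0 -htMM mulVg ht1'.
move: x; apply: generated_min => [|_ [b [g [_ ->]]]].
  split=> [//|y z y0 z0]; suff: ht (sdl (y * z^-1)) = 0%R by [].
  by rewrite htMM htVV y0 z0 subr0.
suff: ht (sdl (inl b * inr g * (inl b)^-1)) = 0%R by [].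
by rewrite !htMM htVV /= ht1 addr0 subrr.
Qed.

(** The generators have height zero, so generating inside [BB_M x| pi] or inside
    [A_M x| pi] gives the same subgroup. *)
Lemma nsub_conj_deck S (x : bb_deck_group p) :
  nsub (N_subgroup p S) x <-> conj_deck S (val x).
Proof.
have valM : {morph (val : bb_deck_group p -> Gamma) : y z / y * z}.
  exact: gmulfM.
have [bb1 bbV] := generated_subgroup (@deck_conjugates _ _ _ p S).
split.
  move: x; apply: (@generated_min _ _ (val @^-1` conj_deck S)).
    exact: morph_preim_subgroup valM (conj_deck_subgroup S).
  move=> y [b [g [Sb yE]]].
  by apply: sub_generated; exists b, g.
move=> Nx.
pose Y := [set y : Gamma | exists2 z, nsub (N_subgroup p S) z & val z = y].
suff [z Nz /val_inj <-] : Y (val x) by [].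
apply: Nx; split; first split.
- by exists 1.
- move=> _ _ [y Ny <-] [z Nz <-]; exists (y * z^-1); first exact: bbV.
  by rewrite valM (morph_inv valM).
- move=> y [b [g [Sb yE]]].
  have y0 : bb_deck y.
    have : conj_deck S y by apply: sub_generated; exists b, g.
    by move/conj_deck_height; rewrite /bb_deck !inE => ->.
  exists (Sub y y0); last by rewrite SubK.
  by apply: sub_generated; exists b, g; rewrite SubK.
Qed.

End Conjugates.

Section Projection.
Variables (R : realType) (M L : simplicial_complex).
Variable p : simplicial_covering R M L.

Local Notation Gamma := (raag_deck p).
Local Notation inl := (sd_inl (raag_action p)).
Local Notation inr := (sd_inr (raag_action p)).

Let proj_rels r : raag_rels M r -> word_val (fun v => raag_gen (p v)) r = 1.
Proof. by apply: raag_relsP => v w /(edge_proj p)/edge_comm. Qed.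

Let projA : raag M -> raag L := pres_lift (fun v => raag_gen (p v)).
Let projAM : {morph projA : x y / x * y} := pres_liftM proj_rels.

Let projA_gen v : projA (raag_gen v) = raag_gen (p v).
Proof. exact: (pres_lift_gen proj_rels). Qed.

Definition raag_proj : Gamma -> raag L := sdprod_lift projA (fun=> 1).

Lemma raag_projM : {morph raag_proj : x y / x * y}.
Proof.
apply: sdprod_liftM => // [y z|g]; first by rewrite mulg1.
apply: presented_ext => [y z|y z|v].
- by rewrite gact_mul projAM.
- by rewrite projAM !mul1g invg1 !mulg1.
- rewrite mul1g invg1 mulg1 [raag_action p g _]raag_act_gen.
  by rewrite -/(raag_gen v) !projA_gen deck_act_over.
Qed.

Lemma raag_proj_gen v : raag_proj (inl (raag_gen v)) = raag_gen (p v).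
Proof. by rewrite /raag_proj /sdprod_lift /= mulg1 projA_gen. Qed.

Lemma raag_proj_inr g : raag_proj (inr g) = 1.
Proof. by rewrite /raag_proj /sdprod_lift /= mulg1 (morph_one projAM). Qed.

Lemma ht_proj x : ht (raag_proj x) = ht (sdl x).
Proof.
rewrite /raag_proj /sdprod_lift mulg1; move: (sdl x) => {x}.
apply: presented_ind => [|v]; last by rewrite /= -/(raag_gen v) projA_gen !ht_gen.
split=> [|y z /= yE zE]; rewrite /= ?(morph_one projAM) ?ht1 //.
by rewrite projAM (morph_inv projAM) !htM !htV yE zE.
Qed.

Lemma raag_proj_conj_deck T x : conj_deck T x -> raag_proj x = 1.
Proof.
apply: (generated_min (morph_kernel_subgroup raag_projM)) => _ [b [g [_ ->]]] /=.
by rewrite !raag_projM (morph_inv raag_projM) raag_proj_inr mulg1 mulgV.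
Qed.

Lemma inr_gen g v :
  inr g * inl (raag_gen v) * (inr g)^-1 = inl (raag_gen (deck_act g v)).
Proof. by rewrite sd_inr_act /= raag_act_gen mulgK. Qed.

(** Modulo the conjugates of [pi], the class of a generator of [A_M] depends only
    on its image in [L], and an edge of [L] lifts to an edge of [M]; this gives
    an inverse of the projection on the quotient. *)
Lemma raag_proj_kernel x : regular_covering (realize R p) ->
  raag_proj x = 1 -> conj_deck setT x.
Proof.
move=> reg x1.
pose N := NormalSubgroup (@conj_deck_subgroup _ _ _ p setT)
  (fun x y => @conj_deck_conj _ _ _ p setT setT y x (fun _ _ => I)).
have NE y : conj_deck setT y <-> \pi_(quotient_group N) y = 1.
  split=> [Ny|/esym/(eq_coset N)]; last by rewrite invg1 mul1g.
  by apply/esym/(eq_coset N); rewrite invg1 mul1g.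
have piM : {morph (\pi_(quotient_group N) : Gamma -> _) : y z / y * z}.
  by move=> y z; rewrite quotient_mulE.
have piK g : \pi_(quotient_group N) (inr g) = 1.
  by apply/NE; apply: conj_deck_inr.
have [lift liftP] := choice (proj_vertex_surj p).
pose j (u : L) := \pi_(quotient_group N) (inl (raag_gen (lift u))).
have jE v : \pi_(quotient_group N) (inl (raag_gen v)) = j (p v).
  have [g gv] := deck_act_transitive reg (liftP (p v)).
  by rewrite -{1}gv -inr_gen !piM (morph_inv piM) piK invg1 mul1g mulg1.
have jrels r : raag_rels L r -> word_val j r = 1.
  apply: raag_relsP => u u' uu'.
  have [w vw <-] : exists2 w, edge (lift u) w & p w = u'.
    by apply: edge_lift; rewrite liftP.
  rewrite -{1}(liftP u) -!jE /commute -!piM -!sd_inlM.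
  by rewrite (edge_comm vw).
have jM := pres_liftM jrels.
suff E y : \pi_(quotient_group N) y = pres_lift j (raag_proj y).
  by apply/NE; rewrite E x1; exact: morph_one jM.
rewrite (sdprod_decomp y) raag_projM raag_proj_inr mulg1 piM piK mulg1.
move: (sdl y) => z; move: z; apply: presented_ext => [z z'|z z'|v].
- by rewrite sd_inlM piM.
- by rewrite sd_inlM raag_projM jM.
- by rewrite -/(raag_gen v) jE raag_proj_gen (pres_lift_gen jrels).
Qed.

End Projection.

(** * The splitting and the retraction of the kernel *)

Section Lift.
Variables (R : realType) (M L : simplicial_complex).
Variable p : simplicial_covering R M L.
Variable S : set int.

Local Notation Gamma := (raag_deck p).
Local Notation inl := (sd_inl (raag_action p)).
Local Notation inr := (sd_inr (raag_action p)).
Local Notation gen v := (inl (raag_gen v)).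
Local Notation W := (coind (@raag_projM _ _ _ p)).
Local Notation rp := (realize R p).

(** The subgroup [N(S + ht x)], modulo which the coordinate at [x] is controlled. *)
Let near_one (x : raag L) : set Gamma := conj_deck [set n | S (n - ht x)%R].

Let near_oneM x : is_subgroup (near_one x) := conj_deck_subgroup _ _.

Let near_one_conj x (y z : Gamma) :
  near_one x y -> near_one (raag_proj z * x) (z * y * z^-1).
Proof.
apply: conj_deck_conj => n /=; rewrite htM ht_proj.
by rewrite opprD addrACA subrr add0r.
Qed.

(** The pairs all of whose coordinates agree with the diagonal element modulo
    [N(S + ht x)]. The shift by [ht x] is what makes them a subgroup: it is
    compatible with the action on the coordinates by [near_one_conj]. *)
Definition near_diag : set W :=
  [set y | forall x, near_one x (coind_val y x * (sdr y)^-1)].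

Lemma near_diag_subgroup : is_subgroup near_diag.
Proof.
split=> [x|y z Vy Vz x].
  have -> : coind_val (1 : W) x * (sdr (1 : W))^-1 = 1 by rewrite mulgV.
  exact: subgroup1.
rewrite coind_valM coind_valV; set w := raag_proj (sdr z) * _.
have {Vz} := @near_one_conj _ _ (sdr z)^-1 (subgroupV (near_oneM w) (Vz w)).
rewrite invgM !invgK mulKg (morph_inv (@raag_projM _ _ _ p)) /w mulKg.
move=> /(@near_one_conj _ _ (sdr y)); rewrite mulVKg.
move/(subgroupM (near_oneM x) (Vy x)).
have -> : sdr (y * z^-1) = sdr y * (sdr z)^-1 by [].
set e := coind_val z _; rewrite -/e; move: e (sdr y) (sdr z) => e g h.
by rewrite invgM invgK -!mulgA mulKg.
Qed.

(** Away from the heights in [S] a deck transformation acts as itself; at the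
    heights in [S] it is replaced by the trivial element. *)
Definition deck_lift (g : deck_group p) : W :=
  Sdprod _ ((fun x => if `[< S (- ht x)%R >] then 1 else inr g) : fun_group _ _)
    (inr g).

Lemma deck_liftM : {morph deck_lift : g h / g * h}.
Proof.
move=> g h; apply: coind_eq => [|x]; first exact: sd_inrM.
rewrite coind_valM /coind_val /= raag_proj_inr invg1 mul1g.
by case: asboolP => _; rewrite ?mulg1 // sd_inrM.
Qed.

Lemma deck_lift_near g : near_diag (deck_lift g).
Proof.
move=> x; rewrite /coind_val /=; case: asboolP => Sx; last first.
  by rewrite mulgV; exact: subgroup1 (near_oneM x).
rewrite mul1g; apply: (subgroupV (near_oneM x)).
by apply: conj_deck_inr; rewrite /= sub0r.
Qed.

Hypotheses (connM : connected_complex R M) (flagL : flag L).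
Hypothesis regp : regular_covering rp.

(** A homomorphism to [W] from the part of [A_M x| pi] that lies over the vertices
    in [U], recorded by the images [C v] of the generators. *)
Record partial_lift (U : seq L) (C : M -> W) : Prop := PartialLift {
  plift_sdr : forall v, p v \in U -> sdr (C v) = gen v;
  plift_near : forall v, p v \in U -> near_diag (C v);
  plift_deck : forall g v, p v \in U ->
    C (deck_act g v) = deck_lift g * C v * (deck_lift g)^-1;
  plift_comm : forall v w, edge v w -> p v \in U -> p w \in U ->
    commute (C v) (C w) }.

Section Extend.
Variables (U : seq L) (C : M -> W) (C_lift : partial_lift U C) (v0 : M).

Let inlink w := edge v0 w /\ p w \in U.

Let link : set (raag L) := generated [set raag_gen (p w) | w in inlink].

(** The link of [v0] maps bijectively to its image, so a vertex [u] in the image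
   has only one preimage to choose. *)
Let r_gen (u : L) : W :=
  if pselect (exists w, inlink w /\ p w = u) is left ex then C (sval (cid ex))
  else 1.

Let r_genP u : (exists w, [/\ inlink w, p w = u & r_gen u = C w]) \/ r_gen u = 1.
Proof.
rewrite /r_gen; case: pselect => [ex|]; last by right.
by left; case: (cid ex) => w [lw pw]; exists w.
Qed.

Let r_genE w : inlink w -> r_gen (p w) = C w.
Proof.
move=> lw; rewrite /r_gen; case: pselect => [ex|[]]; last by exists w.
case: (cid ex) => w' /= [lw' /(star_inj _ _) pw].
by rewrite (pw v0 (proj1 lw') (proj1 lw)).
Qed.

Let r_rels r : raag_rels L r -> word_val r_gen r = 1.
Proof.
apply: raag_relsP => u1 u2 u12.
have [[w1 [[vw1 Uw1] pw1 ->]]|->] := r_genP u1; last exact/commute_sym/commute1.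
have [[w2 [[vw2 Uw2] pw2 ->]]|->] := r_genP u2; last exact: commute1.
apply: (plift_comm C_lift) => //; apply: (link_edge (p := p) flagL vw1 vw2).
by rewrite pw1 pw2.
Qed.

Let r : raag L -> W := pres_lift r_gen.
Let rM : {morph r : x y / x * y} := pres_liftM r_rels.

Let r_link w : inlink w -> r (raag_gen (p w)) = C w.
Proof. by move=> lw; rewrite -(r_genE lw); exact: (pres_lift_gen r_rels). Qed.

Let sdr_r c : link c -> raag_proj (sdr (r c)) = c.
Proof.
have fM : {morph (fun c => raag_proj (sdr (r c))) : x y / x * y}.
  by move=> x y; rewrite rM -raag_projM.
apply: (generated_min (morph_equalizer_subgroup fM (g := id) _)) => //.
move=> _ [w lw <-] /=.
by rewrite r_link // (plift_sdr C_lift) ?raag_proj_gen //; case: lw.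
Qed.

Let r_comm c : link c -> commute (gen v0) (sdr (r c)).
Proof.
have fM : {morph (fun c => sdr (r c)) : x y / x * y} by move=> x y; rewrite rM.
apply: (generated_min (morph_preim_subgroup fM (centralizer_subgroup _))).
move=> _ [w lw <-].
rewrite /preimage /= r_link // (plift_sdr C_lift); last by case: lw.
by rewrite /commute -!sd_inlM (edge_comm (proj1 lw)).
Qed.

Let r_near c : near_diag (r c).
Proof.
apply: (presented_ind (morph_preim_subgroup rM near_diag_subgroup)) => u.
rewrite /preimage /= /r (pres_lift_gen r_rels).
have [[w [[vw Uw] pw ->]]|->] := r_genP u; first exact: (plift_near C_lift).
exact: subgroup1 near_diag_subgroup.
Qed.

(** The map [r] is defined on all of [A_L], by killing the vertices outside the
    link: a full subgraph generates a retract. On the subgroup generated by the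
    link it lifts the identity, so [coind_commutant] applies to it. *)
Lemma vertex_lift : exists y : W, [/\ sdr y = gen v0, near_diag y &
  forall w, edge v0 w -> p w \in U -> commute y (C w)].
Proof.
have [y [y0 yC yE]] := coind_commutant (generated_subgroup _) rM sdr_r r_comm.
exists y; split=> // [x|w vw Uw]; last first.
  have lw : inlink w by [].
  by rewrite -(r_link lw); apply: yC; apply: sub_generated; exists w.
rewrite y0; have [d ld ->] := yE x; have td := r_comm ld.
set t := gen v0 in td *; pose x' : raag L := (raag_proj t)^-1 * x.
have := @near_one_conj _ _ t (subgroupV (near_oneM x') (@r_near d x')).
rewrite /x' mulVKg => /(subgroupM (near_oneM x) (@r_near d x)).
have E (a e g : Gamma) : commute t g ->
    a * g^-1 * (t * (e * g^-1)^-1 * t^-1) = a * t * e^-1 * t^-1.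
  move=> tg; rewrite invgM invgK !mulgA -(mulgA (a * g^-1)) tg mulgA.
  by rewrite mulgVK.
by rewrite E.
Qed.

End Extend.

Let deck_lift_rotate g h y : deck_lift (g * h) * y * (deck_lift (g * h))^-1 =
  deck_lift g * (deck_lift h * y * (deck_lift h)^-1) * (deck_lift g)^-1.
Proof. by rewrite deck_liftM invgM !mulgA. Qed.

(** The lift of one vertex over [u] is transported along the fibre by [pi],
    which acts on it freely and transitively. *)
Lemma partial_lift_extend U C u : u \notin U -> partial_lift U C ->
  exists C', partial_lift (u :: U) C'.
Proof.
move=> uU C_lift; have [v0 pv0] := proj_vertex_surj p u.
have [y [y0 ynear ycomm]] := vertex_lift C_lift v0.
have pick v : exists g : deck_group p, p v = u -> deck_act g v0 = v.
  have [pv|pv] := pselect (p v = u); last by exists 1.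
  by have [g gv] := deck_act_transitive regp (etrans pv0 (esym pv)); exists g.
have [k kP] := choice pick.
have kM g v : p v = u -> k (deck_act g v) = g * k v.
  move=> pv; suff: (k (deck_act g v))^-1 * (g * k v) = 1.
    by move/mulg1_eq; rewrite invgK.
  apply: (deck_act_free (v := v0) connM).
  rewrite !deck_actM kP // -{2}(kP (deck_act g v)) ?deck_act_over //.
  by rewrite -deck_actM mulVg deck_act1.
pose C' v := if p v == u then deck_lift (k v) * y * (deck_lift (k v))^-1 else C v.
have C'u v : p v = u -> C' v = deck_lift (k v) * y * (deck_lift (k v))^-1.
  by rewrite /C' => ->; rewrite eqxx.
have C'U v : p v != u -> C' v = C v by rewrite /C' => /negbTE ->.
have inU v : p v \in u :: U -> p v != u -> p v \in U.
  by rewrite inE => /orP[->|].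
have sgV := near_diag_subgroup.
have comm_u v w : edge v w -> p v = u -> p w \in U -> commute (C' v) (C w).
  move=> vw pv pw; rewrite C'u //.
  have gw : deck_act (k v) (deck_act (k v)^-1 w) = w.
    by rewrite -deck_actM mulgV deck_act1.
  have v0w : edge v0 (deck_act (k v)^-1 w).
    have -> : v0 = deck_act (k v)^-1 v.
      by rewrite -{2}(kP v pv) -deck_actM mulVg deck_act1.
    exact: deck_act_edge.
  rewrite -gw (plift_deck C_lift) ?deck_act_over //.
  have := ycomm _ v0w; rewrite deck_act_over => /(_ pw) yw.
  rewrite /commute !mulgA !mulgVK -!mulgA; congr (_ * _).
  by rewrite 2!mulgA yw.
exists C'; split.
- move=> v vU; have [pv|pv] := eqVneq (p v) u; last first.
    by rewrite C'U // (plift_sdr C_lift) // inU.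
  rewrite C'u //; set a := deck_lift _.
  have -> : sdr (a * y * a^-1) = sdr a * sdr y * (sdr a)^-1 by [].
  by rewrite y0 /= inr_gen kP.
- move=> v vU; have [pv|pv] := eqVneq (p v) u; last first.
    by rewrite C'U //; apply: (plift_near C_lift); exact: inU.
  rewrite C'u //; have gN := deck_lift_near (k v).
  apply: (subgroupM sgV); last exact: (subgroupV sgV).
  exact: (subgroupM sgV).
- move=> g v vU; have [pv|pv] := eqVneq (p v) u; last first.
    by rewrite !C'U ?deck_act_over // (plift_deck C_lift) // inU.
  by rewrite !C'u ?deck_act_over // kM // deck_lift_rotate.
- move=> v w vw vU wU; have [pv|pv] := eqVneq (p v) u.
    have pw : p w != u by have [+ _] := edge_proj p vw; rewrite pv eq_sym.
    by rewrite (C'U w) //; apply: comm_u => //; exact: inU.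
  have [pw|pw] := eqVneq (p w) u.
    apply: commute_sym; rewrite (C'U v) //; apply: comm_u => //; last exact: inU.
    exact: edge_sym.
  by rewrite !C'U //; apply: (plift_comm C_lift) => //; exact: inU.
Qed.

Hypothesis finL : finite_complex L.

(** Since [L] is finite, extending over one vertex at a time reaches all of it. *)
Lemma coind_splitting : exists T : Gamma -> W,
  [/\ {morph T : x y / x * y}, forall x, sdr (T x) = x,
    forall x, near_diag (T x) & forall g, T (inr g) = deck_lift g].
Proof.
have [s sL] : exists s : seq L, forall u, u \in s.
  have /finite_seqP[s sE] := finL; exists s => u.
  have : [set: L] u by [].
  by rewrite sE.
have [C C_lift] : exists C, partial_lift s C.
  elim: {sL} s => [|u s [C Cs]]; first by exists (fun=> 1); split.
  have [us|us] := boolP (u \in s); last exact: partial_lift_extend Cs.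
  have su v : p v \in u :: s -> p v \in s by rewrite inE => /orP[/eqP ->|].
  exists C; case: Cs => C1 C2 C3 C4.
  by split=> [v /su|v /su|g v /su|v w vw /su vs /su]; auto.
have C_rels r : raag_rels M r -> word_val C r = 1.
  by apply: raag_relsP => v w vw; apply: (plift_comm C_lift).
pose f : raag M -> W := pres_lift C.
have fM : {morph f : x y / x * y} := pres_liftM C_rels.
have f_gen v : f (raag_gen v) = C v by exact: (pres_lift_gen C_rels).
have fact g x : f (raag_action p g x) = deck_lift g * f x * (deck_lift g)^-1.
  move: x; apply: presented_ext => [x y|x y|v].
  - by rewrite gact_mul fM.
  - by rewrite fM !mulgA mulgVK.
  - by rewrite [raag_action p g _]raag_act_gen -/(raag_gen v) !f_gen (plift_deck C_lift).
have TM := sdprod_liftM fM deck_liftM fact.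
exists (sdprod_lift f deck_lift); split=> // [x|x|g].
- rewrite [RHS]sdprod_decomp /sdprod_lift; congr (_ * _).
  move: (sdl x); apply: presented_ext => [y z|y z|v]; rewrite ?fM ?sd_inlM //.
  by rewrite -/(raag_gen v) f_gen (plift_sdr C_lift).
- apply: (subgroupM near_diag_subgroup); last exact: deck_lift_near.
  move: (sdl x); apply: (presented_ind (morph_preim_subgroup fM near_diag_subgroup)) => v.
  by rewrite /preimage /= -/(raag_gen v) f_gen; apply: (plift_near C_lift).
- by rewrite /sdprod_lift /= (morph_one fM) mul1g.
Qed.

(** The map [f] is the coordinate at [1] of the splitting; the kernel of the
    projection fixes that coordinate, so [f] is multiplicative there. The value
    of [f] at [b g b^-1] is conjugate to the coordinate of [deck_lift g] at
    the inverse of the image of [b], whence the sign in [deck_lift]. *)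
Lemma kernel_retraction : exists f : Gamma -> Gamma,
  [/\ forall x y, raag_proj x = 1 -> f (x * y) = f x * f y,
    forall x, conj_deck S (f x * x^-1),
    forall x, conj_deck S x -> f x = 1 &
    forall b g, ~ S (ht b) -> f (inl b * inr g * (inl b)^-1) = 1 -> g = 1].
Proof.
have [T [TM Tsdr Tnear Tinr]] := coind_splitting.
pose f x : Gamma := coind_val (T x) 1.
have fM x y : raag_proj x = 1 -> f (x * y) = f x * f y.
  by move=> x1; rewrite /f TM coind_valM Tsdr x1 invg1 mul1g.
have fJ b g : f (inl b * inr g * (inl b)^-1) =
    f (inl b) * coind_val (deck_lift g) (raag_proj (inl b))^-1 * (f (inl b))^-1.
  apply: (mulIg (f (inl b))); rewrite mulgVK -fM ?mulgVK.
    by rewrite {1}/f TM coind_valM Tsdr Tinr mulg1.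
  by rewrite !raag_projM (morph_inv (@raag_projM _ _ _ p)) raag_proj_inr mulg1 mulgV.
have dlE b g : coind_val (deck_lift g) (raag_proj (inl b))^-1 =
    if `[< S (ht b) >] then 1 else inr g.
  by rewrite /coind_val /= htV ht_proj /= opprK.
have f1 : f 1 = 1.
  apply: (mulgI (f 1)); rewrite mulg1 -fM ?mulg1 //.
  exact: morph_one (@raag_projM _ _ _ p).
exists f; split=> // [x|x|b g Sb].
- have := Tnear x 1; rewrite Tsdr /near_one ht1.
  by under eq_set do rewrite subr0.
- suff : conj_deck S `<=` [set y | raag_proj y = 1 /\ f y = 1].
    by move=> + Sx => /(_ x Sx)[].
  apply: generated_min => [|_ [b [g [Sb ->]]]]; last first.
    rewrite /= fJ dlE asboolT // mulg1 mulgV; split=> //.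
    by apply: (raag_proj_conj_deck (T := S)); apply: sub_generated; exists b, g.
  split=> [|y z [y1 fy1] [z1 fz1]].
    by rewrite /= f1 (morph_one (@raag_projM _ _ _ p)).
  have fV : f z^-1 = 1 by rewrite -[LHS]mul1g -{1}fz1 -fM // mulgV.
  split; last by rewrite fM // fy1 fV mulg1.
  by rewrite raag_projM (morph_inv (@raag_projM _ _ _ p)) y1 z1 invg1 mulg1.
- rewrite fJ dlE asboolF // => /(congr1 (fun z => (f (inl b))^-1 * z * f (inl b))).
  by rewrite !mulgA mulgVK mulVg mul1g mulg1 mulVg => -[].
Qed.

End Lift.

(** * Torsion in the quotient group *)

Section Torsion.
Variables (R : realType) (M L : simplicial_complex).
Variable p : simplicial_covering R M L.
Variable S : set int.
Hypotheses (neL : [set: L] !=set0) (finL : finite_complex L).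
Hypotheses (connM : connected_complex R M) (flagL : flag L).
Hypothesis regp : regular_covering (realize R p).

Local Notation Gamma := (raag_deck p).
Local Notation inl := (sd_inl (raag_action p)).
Local Notation inr := (sd_inr (raag_action p)).
Local Notation N := (N_subgroup p S).

Let GLM_eq1 (x : bb_deck_group p) :
  \pi_(GLM p S) x = 1 <-> conj_deck S (val x).
Proof.
rewrite -nsub_conj_deck; split=> [/esym/(eq_coset N)|Nx]; last apply/esym/(eq_coset N).
  by rewrite invg1 mul1g.
by rewrite invg1 mul1g.
Qed.

Let GLM_exp (x : bb_deck_group p) n : (\pi_(GLM p S) x) ^+ n = \pi_(GLM p S) (x ^+ n).
Proof.
have piM : {morph (\pi_(GLM p S) : bb_deck_group p -> _) : y z / y * z}.
  by move=> y z; exact/esym/quotient_mulE.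
by rewrite (morph_exp piM).
Qed.

Let valX (x : bb_deck_group p) n : val (x ^+ n) = val x ^+ n.
Proof.
have valM : {morph (val : bb_deck_group p -> Gamma) : y z / y * z} by exact: gmulfM.
exact: (morph_exp valM).
Qed.

Let raag_height n : exists b : raag M, ht b = n.
Proof.
have [u _] := neL; have [v _] := proj_vertex_surj p u.
have htX k : ht (raag_gen v ^+ k) = Posz k.
  by elim: k => [|k IHk]; rewrite ?ht1 // expgS htM ht_gen IHk intS.
case: n => k; first by exists (raag_gen v ^+ k).
by exists (raag_gen v ^+ k.+1)^-1; rewrite htV htX NegzE.
Qed.

(** For [b] of a height outside [S], a torsion element [g] of [pi] gives the
    torsion element [b g b^-1], whose class is not trivial unless [g] is. *)
Lemma torsion_free_deck : torsion_free (GLM p S) -> S <> setT ->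
  torsion_free (deck_group p).
Proof.
move=> tf ST g m m0 gm.
have [n Sn] : exists n, ~ S n.
  apply: contrapT => nS; apply: ST; apply/seteqP; split=> // n _.
  by apply: contrapT => Sn; apply: nS; exists n.
have [b bn] := raag_height n.
have [f [_ _ fN fJ]] := kernel_retraction S connM flagL regp finL.
apply: (fJ b); first by rewrite bn.
set y := inl b * inr g * (inl b)^-1.
have y0 : bb_deck y.
  have : conj_deck setT y by apply: sub_generated; exists b, g.
  by move/conj_deck_height; rewrite /bb_deck !inE => ->.
have ym : y ^+ m = 1.
  rewrite /y; transitivity (inl b * inr (g ^+ m) * (inl b)^-1).
    rewrite (morph_exp (@sd_inrM _ _ _)); elim: (m) => [|k IHk].
      by rewrite mulg1 mulgV.
    by rewrite !expgS IHk !mulgA mulgVK.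
  by rewrite gm [inr 1](morph_one (@sd_inrM _ _ _)) mulg1 mulgV.
apply: fN; have <- : val (Sub y y0 : bb_deck_group p) = y by rewrite SubK.
apply/GLM_eq1; apply: (tf _ m m0); rewrite GLM_exp; apply/GLM_eq1.
by rewrite valX SubK ym; exact: subgroup1 (conj_deck_subgroup _ _).
Qed.

(** The image of a torsion element in [A_L] is trivial, hence the element lies
    in the subgroup generated by the conjugates of [pi]. If [S] omits a height,
    the retraction of this subgroup moves it to a torsion element of
    [A_M x| pi] in the same class. *)
Lemma torsion_free_quotient : S = setT \/ torsion_free (deck_group p) ->
  torsion_free (GLM p S).
Proof.
move=> Spi z n n0; have [x ->] := quotient_groupW z.
rewrite GLM_exp => /GLM_eq1; rewrite valX => Nxn; apply/GLM_eq1.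
move: (val x) Nxn => y Nyn.
have y1 : raag_proj y = 1.
  apply: (raag_torsion_free n0).
  by rewrite -(morph_exp (@raag_projM _ _ _ p)) (raag_proj_conj_deck Nyn).
have [->|tfpi] := Spi; first exact: raag_proj_kernel.
have [f [fM f_near fN _]] := kernel_retraction S connM flagL regp finL.
have fX k : f (y ^+ k) = f y ^+ k.
  elim: k => [|k IHk]; last by rewrite !expgS fM // IHk.
  by rewrite !expg0; apply: fN; exact: subgroup1 (conj_deck_subgroup _ _).
have fy : f y = 1.
  have tfG : torsion_free Gamma.
    by apply: sdprod_torsion_free => //; exact: raag_torsion_free.
  by apply: (tfG _ n n0); rewrite -fX fN.
have := f_near y; rewrite fy mul1g => /(subgroupV (conj_deck_subgroup _ _)).
by rewrite invgK.
Qed.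

End Torsion.

Theorem proposition1p1 (R : realType) (L M : simplicial_complex)
    (p : simplicial_covering R M L) (S : set int) :
  [set: L] !=set0 ->
  finite_complex L ->
  connected_complex R L ->
  flag L ->
  connected_complex R M ->
  regular_covering (realize R p) ->
  torsion_free (GLM p S) <->
    (S = [set: int] \/ torsion_free (deck_group p)).
Proof.
move=> neL finL _ flagL connM regp; split; last exact: torsion_free_quotient.
have [->|ST] := pselect (S = setT); first by left.
by move=> tf; right; exact: (torsion_free_deck neL finL connM flagL regp tf ST).
Qed.
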